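(* Let $f$ be a field of characteristic $p>0$, and let $m\ge0$ and $n$ be integers with $m<n\le p-2$. (1) If $n\le 2m+2$, all the orbits of the co-adjoint representation of $G_{m+1,n+1}$ in $L_{m+1,n+1}^*$ are points, and every point is an orbit; all orbits are in general position. (2) If $n>2m+2$ and $n$ is odd, the orbits in general position of the co-adjoint representation of $G_{m+1,n+1}$ in $L_{m+1,n+1}^*$ are parametrized by $m+1$ numbers $c_0\in f^*=f\setminus\{0\}$, $c_1,\dots,c_m\in f$: they are the affine planes of dimension $n-2m-1$ defined by the equations $l_n=c_0,\ l_{n-1}=c_1,\dots,l_{n-m}=c_m$. (3) If $n>2m+2$ and $n$ is even, the orbits in general position are parametrized by $m+2$ numbers $c_0\in f^*$, $c_1,\dots,c_{m+1}\in f$: they are the affine varieties of dimension $n-2m-2$ defined by the equations $l_n=c_0,\ l_{n-1}=c_1,\dots,l_{n-m}=c_m,\ P_{mk}(l_n,l_{n-1},\dots,l_{n/2})=c_{m+1}$ with $k=(n/2)-m$. (4) Each orbit in general position of the co-adjoint representation of $G_{m+1,n+1}$ in $L_{m+1,n+1}^*$ is an orbit of the co-adjoint representation of $G_{m+1,i+1}$ in $L_{m+1,i+1}^*$ for all $i$ with $n\le i\le p-2$ (for $i=p-2$ this is the co-adjoint representation of $G_{m+1}$ in $L_{m+1}^*$). (5) For every integer $i$ with $m<i\le p-2$, each orbit of the co-adjoint representation of $G_{m+1,i+1}$ in $L_{m+1,i+1}^*$ is an orbit in general position of the co-adjoint representation of $G_{m+1,n'+1}$ in $L_{m+1,n'+1}^*$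 for some $n'$ with $\min(2m+2,i)\le n'\le i$ (for $i=p-2$ this concerns the orbits of $G_{m+1}$ in $L_{m+1}^*$).
   Context: $W_1$ is the Lie algebra of $f$-derivations of $f[t]/(t^p)$, with basis $l_i=t^{i+1}\frac{d}{dt}$, $-1\le i\le p-2$, so $[l_i,l_j]=(j-i)l_{i+j}$ with $l_{i+j}=0$ for $i+j\ge p-1$. $L_n$ consists of the elements $\sum_{i=-1}^{p-2}a_il_i$ with $a_i=0$ for $i<n$. For $0\le m\le n\le p-1$, $L_{mn}=L_m/L_n$, with $L_{m,p-1}=L_m$; a basis is given by the classes of $l_m,\dots,l_{n-1}$, still denoted $l_i$. $L_{mn}^*$ is the dual space, each $l_i$ being regarded as a linear coordinate function on it; the projections $L_{mi}\to L_{mn}$ ($n\le i$) induce inclusions $L_{mn}^*\subset L_{mi}^*$. $G_0$ is the group of automorphisms of $f[t]/(t^p)$ leaving the constants fixed; for $1\le n\le p-1$, $G_n$ is the subgroup of automorphisms with $g(t)=t+o(t^n)$, where $o(t^n)$ denotes terms of degree $>n$; $G_{mn}=G_m/G_n$ for $0\le m\le n\le p-1$ (so $G_{m,p-1}=G_m$). $G_m$ acts on $L_m$ by conjugation of derivations, inducing an action of $G_{mn}$ on $L_{mn}$ for $m\ge1$; the co-adjoint representation is the dual action on $L_{mn}^*$. An orbit of $G_{m+1,n+1}$ in $L_{m+1,n+1}^*$ is ''in general position'' if $n\le2m+2$ (any orbit), or if $n>2m+2$ and $l_n\ne0$ on it. The polynomials $P_{mk}$ are defined over $\mathbb{Z}[1/2]$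 by $$\sum_{k=1}^{\infty}P_{mk}(x_0,x_1,\dots,x_{m+k})z^k=\frac{\sqrt{\sum_{k=0}^{\infty}x_kx_0^{k-1}z^k}-\sqrt{\sum_{k=0}^{m}x_kx_0^{k-1}z^k}}{x_0^mz^m},$$ the square roots being the power series in $z$ with constant term $1$. (In (3), $p>2$ automatically.) *)

(* Defs.v *)
From HB Require Import structures.
From mathcomp Require Import all_boot all_order all_algebra.
From mathcomp Require Import boolp classical_sets functions.
From mathcomp Require Import mpoly.

Set Implicit Arguments.
Unset Strict Implicit.
Unset Printing Implicit Defensive.

Import GRing.Theory.
Local Open Scope ring_scope.
Local Open Scope classical_set_scope.

Notation trunc f p := {poly %/ ('X^p : {poly f})}.

(* The basis element l_i = t^(i+1) d/dt of W_1.  The index -1 is left out: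
   only the subalgebras L_n with n >= 0 are used. *)
Definition lder (f : fieldType) (p i : nat) : 'End(trunc f p) :=
  linfun (fun q : trunc f p =>
            in_qpoly 'X^p 'X ^+ i.+1 * in_qpoly 'X^p (q : {poly f})^`()).

Lemma lderE (f : fieldType) (p i : nat) (q : trunc f p) :
  lder f p i q = in_qpoly 'X^p 'X ^+ i.+1 * in_qpoly 'X^p (q : {poly f})^`().
Proof.
pose h := fun q : trunc f p =>
  in_qpoly 'X^p 'X ^+ i.+1 * in_qpoly 'X^p (q : {poly f})^`() : trunc f p.
have hlin : linear h.
  move=> a u v.
  by rewrite /h /= derivD derivZ in_qpolyD in_qpolyZ mulrDr -scalerAr.
pose H := GRing.isLinear.Build _ _ _ _ h hlin.
pose hL : {linear _ -> _} := HB.pack h H.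
exact: (lfunE hL).
Qed.

(* The span of the l_i with n <= i <= p - 2. *)
Definition Lsub (f : fieldType) (p n : nat) : {vspace 'End(trunc f p)} :=
  <<[seq lder f p i | i <- iota n (p.-1 - n)]>>%VS.

(* Automorphisms fixing the constants: elements of ['End(_)] are f-linear. *)
Definition is_aut (f : fieldType) (p : nat) (g : 'End(trunc f p)) : Prop :=
  bijective g /\ monoid_morphism g.

Definition Gsub (f : fieldType) (p n : nat) : set 'End(trunc f p) :=
  [set g | is_aut g /\ exists u : trunc f p,
     g (in_qpoly 'X^p 'X) = in_qpoly 'X^p 'X + in_qpoly 'X^p 'X ^+ n.+1 * u].

Arguments Gsub : clear implicits.

(* The elements of G_mn = G_m / G_n: the cosets g G_n with g in G_m. *)
Definition Gquo (f : fieldType) (p m n : nat) : set (set 'End(trunc f p)) :=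
  [set C | exists2 g, Gsub f p m g & C = [set (g \o h)%VF | h in Gsub f p n]].

Arguments Gquo : clear implicits.

Notation Ldual f p m := 'Hom(subvs_of (Lsub f p m), f^o).

(* L_mn^* = (L_m / L_n)^*, realized as the linear functionals on L_m that
   vanish on L_n; the inclusions of L_mn^* into L_mi^* for n <= i, dual to the
   projections, are then inclusions of subsets of L_m^*. *)
Definition Lquodual (f : fieldType) (p m n : nat) : set (Ldual f p m) :=
  [set lam | forall x, vsval x \in Lsub f p n -> lam x = 0].

Arguments Lquodual : clear implicits.

(* The coordinate function l_i on L_m^*, for m <= i <= p - 2. *)
Definition ell (f : fieldType) (p m i : nat) (lam : Ldual f p m) : f :=
  lam (vsproj (Lsub f p m) (lder f p i)).

(* (g . lam) (x) = lam (g^-1 x g): dual of the conjugation x |-> g x g^-1.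
   The projection [vsproj] is only there for typing when g is in G_m. *)
Definition coad (f : fieldType) (p m : nat) (g : 'End(trunc f p))
    (lam : Ldual f p m) : Ldual f p m :=
  linfun (fun x => lam (vsproj (Lsub f p m) (g^-1 \o (vsval x \o g))%VF)).

Lemma coadE (f : fieldType) (p m : nat) (g : 'End(trunc f p))
    (lam : Ldual f p m) x :
  coad g lam x = lam (vsproj (Lsub f p m) (g^-1 \o (vsval x \o g))%VF).
Proof.
pose h := fun x : subvs_of (Lsub f p m) =>
  lam (vsproj (Lsub f p m) (g^-1 \o (vsval x \o g))%VF).
have hlin : linear (h : _ -> f^o).
  move=> a u v; rewrite /h linearP comp_lfunDl comp_lfunDr.
  by rewrite -comp_lfunZl -comp_lfunZr linearP linearP.
pose H := GRing.isLinear.Build _ _ _ _ h hlin.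
pose hL : {linear _ -> _} := HB.pack h H.
exact: (lfunE hL).
Qed.

(* The orbit of lam under G_mn; an element of G_mn acts through any of its
   representatives, as G_n acts trivially on L_mn^* when 1 <= m. *)
Definition coad_orbit (f : fieldType) (p m n : nat) (lam : Ldual f p m) :
    set (Ldual f p m) :=
  \bigcup_(C in Gquo f p m n) [set coad g lam | g in C].

Definition orbits (f : fieldType) (p m n : nat) : set (set (Ldual f p m)) :=
  [set coad_orbit n lam | lam in Lquodual f p m n].

Arguments orbits : clear implicits.

(* The orbits in general position of G_{m+1,n+1} in L_{m+1,n+1}^*: note the
   index shift with respect to [orbits]. *)
Definition gp_orbits (f : fieldType) (p m n : nat) :
    set (set (Ldual f p m.+1)) :=
  [set O | orbits f p m.+1 n.+1 O /\
     ((n <= 2 * m + 2)%N \/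
      ((2 * m + 2 < n)%N /\ forall lam, O lam -> ell n lam != 0))].

Arguments gp_orbits : clear implicits.

Fixpoint sqrt_prefix (f : fieldType) (R : comAlgType f) (a : nat -> R)
    (N : nat) : seq R :=
  if N is N'.+1 then
    let s := sqrt_prefix a N' in
    rcons s (2^-1 *: (a N - \sum_(1 <= i < N) s`_i * s`_(N - i)))
  else [:: 1].

(* The coefficients of the square root, with constant term 1, of the power
   series with coefficients a (where a 0 = 1 and 2 is invertible). *)
Definition sqrt_series (f : fieldType) (R : comAlgType f) (a : nat -> R)
    (N : nat) : R := (sqrt_prefix a N)`_N.

Lemma size_sqrt_prefix (f : fieldType) (R : comAlgType f) (a : nat -> R) N :
  size (sqrt_prefix a N) = N.+1.
Proof. by elim: N => //= N IH; rewrite size_rcons IH. Qed.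

Lemma nth_sqrt_prefix (f : fieldType) (R : comAlgType f) (a : nat -> R) N i :
  (i <= N)%N -> (sqrt_prefix a N)`_i = sqrt_series a i.
Proof.
elim: N => [|N IH]; first by rewrite leqn0 => /eqP ->.
rewrite leq_eqVlt => /orP[/eqP -> //|]; rewrite ltnS => leiN /=.
by rewrite nth_rcons size_sqrt_prefix ltnS leiN IH.
Qed.

Lemma sqrt_series0 (f : fieldType) (R : comAlgType f) (a : nat -> R) :
  sqrt_series a 0 = 1.
Proof. by []. Qed.

Lemma sqrt_seriesS (f : fieldType) (R : comAlgType f) (a : nat -> R) N :
  (0 < N)%N ->
  sqrt_series a N = 2^-1 *:
    (a N - \sum_(1 <= i < N) sqrt_series a i * sqrt_series a (N - i)).
Proof.
case: N => // N _; rewrite {1}/sqrt_series /= nth_rcons size_sqrt_prefix.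
rewrite ltnn eqxx; congr (_ *: (_ - _)); apply: eq_big_nat => i /andP[i0 iN].
case: i i0 iN => // i _ iN.
by rewrite !nth_sqrt_prefix // subSS leq_subr.
Qed.

Lemma sqrt_seriesP (f : fieldType) (R : comAlgType f) (a : nat -> R) N :
  (2 : f) != 0 -> a 0%N = 1 ->
  \sum_(0 <= i < N.+1) sqrt_series a i * sqrt_series a (N - i) = a N.
Proof.
move=> two_neq0 a0; case: N => [|N].
  by rewrite big_nat1 sqrt_series0 mulr1.
rewrite big_ltn // big_nat_recr //= subn0 subnn sqrt_series0 mul1r mulr1.
rewrite addrCA -mulr2n [X in X *+ 2]sqrt_seriesS // -scaler_nat scalerA.
by rewrite mulfV // scale1r addrC subrK.
Qed.

(* The coefficients of sum_{j <= M} x_j x_0^(j-1) z^j, where x_0, ..., x_K are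
   the variables of [{mpoly f[K.+1]}]; the constant term is 1. *)
Definition radicand (f : fieldType) (K M j : nat) : {mpoly f[K.+1]} :=
  if j == 0%N then 1
  else if (j <= M)%N then 'X_(inord j) * 'X_ord0 ^+ j.-1 else 0.

(* The coefficient of z^(m+k) in the difference of the two square roots.  The
   terms of the first radicand of degree > m + k in z do not contribute to it,
   so that only the variables x_0, ..., x_(m+k) are needed. *)
Definition sqrt_diff (f : fieldType) (m k : nat) : {mpoly f[(m + k).+1]} :=
  sqrt_series (radicand f (m + k) (m + k)) (m + k)
  - sqrt_series (radicand f (m + k) m) (m + k).

Lemma sqrt_diff_divisible (f : fieldType) (m k : nat) :
  exists P : {mpoly f[(m + k).+1]}, 'X_ord0 ^+ m * P == sqrt_diff f m k.
Proof.
rewrite /sqrt_diff; set K := (m + k)%N.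
set a := radicand f K K; set b := radicand f K m.
suff H N : (N <= K)%N -> exists P : {mpoly f[K.+1]},
    'X_ord0 ^+ m * P = sqrt_series a N - sqrt_series b N /\
    ((N <= m)%N -> P = 0).
  by have [P [E _]] := H K (leqnn K); exists P; apply/eqP.
elim/ltn_ind: N => N IH leNK.
have [->|N_gt0] := posnP N.
  by exists 0; rewrite mulr0 !sqrt_series0 subrr.
pose sa := sqrt_series a; pose sb := sqrt_series b.
have [leNm|ltmN] := leqP N m.
  exists 0; split=> //; rewrite mulr0; apply/esym/eqP; rewrite subr_eq0.
  have eqs i : (i < N)%N -> sa i = sb i.
    move=> ltiN; have [P [E P0]] := IH i ltiN (ltnW (leq_trans ltiN leNK)).
    apply/eqP; rewrite -subr_eq0 -E P0 ?mulr0 //.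
    exact: leq_trans (ltnW ltiN) leNm.
  rewrite !sqrt_seriesS //; apply/eqP; congr (_ *: (_ - _)).
    by rewrite /a /b /radicand leNm leNK.
  apply: eq_big_nat => i /andP[i0 iN]; rewrite -/sa -/sb !eqs //.
  by rewrite ltn_subrL i0 N_gt0.
have difM i : (0 < i < N)%N -> exists Q : {mpoly f[K.+1]},
    'X_ord0 ^+ m * Q = sa i * sa (N - i)%N - sb i * sb (N - i)%N.
  move=> /andP[i_gt0 ltiN].
  have [P [EP _]] := IH i ltiN (ltnW (leq_trans ltiN leNK)).
  have ltN : (N - i < N)%N by rewrite ltn_subrL i_gt0 N_gt0.
  have [Q [EQ _]] := IH (N - i)%N ltN (ltnW (leq_trans ltN leNK)).
  exists (P * sa (N - i)%N + sb i * Q).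
  rewrite mulrDr mulrA EP mulrCA EQ -/sa -/sb mulrBl mulrBr addrA.
  by rewrite subrK.
have [Q EQ] : exists Q : {mpoly f[K.+1]}, 'X_ord0 ^+ m * Q =
    \sum_(1 <= i < N) (sa i * sa (N - i)%N - sb i * sb (N - i)%N).
  rewrite big_seq_cond; elim/big_ind: _.
  - by exists 0; rewrite mulr0.
  - by move=> x y [Q1 E1] [Q2 E2]; exists (Q1 + Q2); rewrite mulrDr E1 E2.
  - by move=> i; rewrite mem_index_iota andbT => /difM.
exists (2^-1 *: ('X_(inord N) * 'X_ord0 ^+ (N.-1 - m) - Q)); split=> //.
rewrite !sqrt_seriesS // -scalerBr -scalerAr; congr (_ *: _).
have ->: b N = 0 by rewrite /b /radicand gtn_eqF // leqNgt ltmN.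
have ->: a N = 'X_(inord N) * 'X_ord0 ^+ N.-1.
  by rewrite /a /radicand gtn_eqF // leNK.
rewrite mulrBr EQ mulrCA -exprD subnKC; last by case: (N) ltmN.
rewrite sumrB sub0r opprK opprB -!addrA; congr (_ + _).
by rewrite addrC.
Qed.

(* The image over f of the polynomial P_mk with coefficients in Z[1/2], when 2
   is invertible in f: the same generating series defines it over f, and it is
   determined by x_0^m P_mk = sqrt_diff, as x_0 is not a zero divisor. *)
Definition Pmk (f : fieldType) (m k : nat) : {mpoly f[(m + k).+1]} :=
  xchoose (sqrt_diff_divisible f m k).

Lemma PmkE (f : fieldType) (m k : nat) : 'X_ord0 ^+ m * Pmk f m k = sqrt_diff f m k.
Proof. exact/eqP/(xchooseP (sqrt_diff_divisible f m k)). Qed.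

Definition affine_plane (f : fieldType) (V : vectType f) (d : nat)
    (S : set V) : Prop :=
  exists (a : V) (U : {vspace V}), \dim U = d /\ S = [set x | x - a \in U].

Section Ideals.
Context (f : fieldType) (N : nat).

Definition ideal_gen (E : seq {mpoly f[N]}) : set {mpoly f[N]} :=
  [set q | exists a : 'I_(size E) -> {mpoly f[N]}, q = \sum_i a i * E`_i].

Definition prime_ideal (I : set {mpoly f[N]}) : Prop :=
  ~ I 1 /\ forall a b, I (a * b) -> I a \/ I b.

(* The classes of q_1, ..., q_d modulo I are algebraically independent. *)
Definition alg_indep_mod (I : set {mpoly f[N]}) (d : nat)
    (q : d.-tuple {mpoly f[N]}) : Prop :=
  forall R : {mpoly f[d]}, I (R \mPo q) -> R = 0.

(* The equations E define an (irreducible) affine variety over f of dimension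
   d: the coordinate ring f[X_1, ..., X_N]/(E) is a domain, of transcendence
   degree d over f.  The field f may be finite, hence the use of the coordinate
   ring instead of the set of f-rational points. *)
Definition affine_variety (d : nat) (E : seq {mpoly f[N]}) : Prop :=
  [/\ prime_ideal (ideal_gen E),
      exists q : d.-tuple {mpoly f[N]}, alg_indep_mod (ideal_gen E) q &
      forall q : d.+1.-tuple {mpoly f[N]}, ~ alg_indep_mod (ideal_gen E) q].

End Ideals.

Definition orbit_plane (f : fieldType) (p m n : nat) (c : 'I_m.+1 -> f) :
    set (Ldual f p m.+1) :=
  [set lam | Lquodual f p m.+1 n.+1 lam /\
     forall j : 'I_m.+1, ell (n - j) lam = c j].

Arguments orbit_plane : clear implicits.

(* The space L_{m+1,n+1}^* has the n - m coordinates l_n, ..., l_{m+1}; the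
   variable of index j stands for l_{n-j}. *)
Definition zero_locus (f : fieldType) (p m n : nat)
    (E : seq {mpoly f[(n - m.+1).+1]}) : set (Ldual f p m.+1) :=
  [set lam | Lquodual f p m.+1 n.+1 lam /\
     forall q, q \in E ->
       q.@[fun j : 'I_(n - m.+1).+1 => ell (n - j) lam] = 0].

Arguments zero_locus : clear implicits.

(* l_n = c_0, ..., l_{n-m} = c_m and P_mk(l_n, ..., l_{n/2}) = c_{m+1}, where
   k = n/2 - m. *)
Definition orbit_equations (f : fieldType) (m n : nat) (c : 'I_m.+2 -> f) :
    seq {mpoly f[(n - m.+1).+1]} :=
  rcons [seq 'X_(inord j) - (c (widen_ord (leqnSn _) j))%:MP
        | j : 'I_m.+1 <- enum 'I_m.+1]
    (Pmk f m (n./2 - m)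
       \mPo [tuple 'X_(inord j) | j < (m + (n./2 - m)).+1]
     - (c ord_max)%:MP).

Arguments orbit_equations : clear implicits.

(* Main.v *)
From HB Require Import structures.
Require Import Defs.
From mathcomp Require Import all_boot all_order all_algebra.
From mathcomp Require Import boolp classical_sets functions.
From mathcomp Require Import mpoly ring zify.

(** Write a functional lam on L_(m+1) that vanishes on L_(n+1) as the quadratic
    differential with the polar part
    (l_n t^(-n-2) + ... + l_(m+1) t^(-m-3)) dt^2, the values being those of the
    coordinates at lam: lam (a d/dt) is the residue of its product with
    a d/dt.  Residues do not depend on the coordinate t
    ([residue_change_of_variable]; the poles have order at most p, for which
    the usual argument with exact differentials works in characteristic p), and
    therefore the co-adjoint action is the pullback of
    quadratic differentials by changes of coordinate ([ell_coad]).  An orbit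
    of G_(m+1,n+1) is one of G_(m+1) ([coad_orbitE]), which gives (4), and (5)
    with n' the index of the last nonzero coordinate, or min (2m+2, i) if that
    index is smaller.

    The substitution t -> t + a t^(j+1) + ..., where j > m, fixes l_n, ...,
    l_(n-j+1) and adds a (2j - n) l_n to l_(n-j) ([coad_first_order]).  Thus
    l_n, ..., l_(n-m) are invariant.  If n <= 2m+2 the only other coordinate
    that can occur is the one with j = m+1 and n = 2j, which is also fixed, and
    the action is trivial.  Otherwise, if l_n is not 0, the coordinates l_(n-j)
    with 2j different from n can be adjusted one after the other to any value
    ([coad_transitive]), as 2j - n is invertible: its absolute value is less
    than p.  For odd n this proves that the orbits are the planes where
    l_n, ..., l_(n-m) are constant.

    For n = 2K the coordinate l_K is left.  Here the square root of the
    quadratic differential is a differential with a pole of order K+1, whose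
    residue is invariant ([coad_Pmk]).  Up to a scaling by a power of l_n and a
    function of l_n, ..., l_(n-m), the residue is P_mk (l_n, ..., l_K)
    with k = K - m ([Pmk_eval_eq]), a polynomial of degree 1 in l_K with a
    coefficient that is a power of l_n divided by 2 ([Pmk_split]).  So its value
    determines l_K, and the orbits are the level sets of l_n, ..., l_(n-m) and
    P_mk.  For the same reason such a level set is the graph of a polynomial
    map over an affine space, hence an irreducible variety of the expected
    dimension ([graph_affine_variety]); that d + 1 polynomials in d variables
    are algebraically dependent is proved by counting monomials
    ([alg_dependent]). *)

Set Implicit Arguments.
Unset Strict Implicit.
Unset Printing Implicit Defensive.

Import GRing.Theory.
Local Open Scope ring_scope.
Local Open Scope classical_set_scope.

(** * Congruences modulo powers of X, residues and quadratic differentials *)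

Section Congruence.
Variable f : fieldType.
Implicit Types A B C D : {poly f}.

Definition eqX n A B := exists C, A = B + 'X^n * C.

Lemma eqX_refl n A : eqX n A A.
Proof. by exists 0; rewrite mulr0 addr0. Qed.

Lemma eqX_sym n A B : eqX n A B -> eqX n B A.
Proof. by case=> C ->; exists (- C); rewrite mulrN addrK. Qed.

Lemma eqX_trans n A B C : eqX n A B -> eqX n B C -> eqX n A C.
Proof. by case=> D -> [E ->]; exists (E + D); rewrite mulrDr addrA. Qed.

Lemma eqX_le n k A B : (k <= n)%N -> eqX n A B -> eqX k A B.
Proof.
move=> le_kn [C ->]; exists ('X^(n - k) * C).
by rewrite mulrA -exprD subnKC.
Qed.

Lemma eqXM n A B C D : eqX n A B -> eqX n C D -> eqX n (A * C) (B * D).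
Proof.
case=> E -> [F ->]; exists (B * F + E * D + 'X^n * E * F).
by ring.
Qed.

Lemma eqXr n A B C : eqX n B C -> eqX n (A * B) (A * C).
Proof. exact/eqXM/eqX_refl. Qed.

Lemma eqXl n A B C : eqX n A B -> eqX n (A * C) (B * C).
Proof. move=> h; exact: eqXM h (eqX_refl _ _). Qed.

Lemma eqXX n k A B : eqX n A B -> eqX n (A ^+ k) (B ^+ k).
Proof.
move=> h; elim: k => [|k IH]; first exact: eqX_refl.
by rewrite !exprS; apply: eqXM.
Qed.

Lemma eqX_coef n A B i : eqX n A B -> (i < n)%N -> A`_i = B`_i.
Proof.
by case=> C -> lt_in; rewrite coefD mulrC coefMXn lt_in addr0.
Qed.

Lemma coef_eqX n A B : (forall i, (i < n)%N -> A`_i = B`_i) -> eqX n A B.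
Proof.
move=> h; exists (drop_poly n (A - B)).
have /esym E := poly_take_drop n (A - B).
have T : take_poly n (A - B) = 0.
  apply/polyP=> i; rewrite coef_take_poly coef0 coefB.
  by case: ifP => // /h ->; rewrite subrr.
by rewrite T add0r in E; rewrite mulrC -E addrC subrK.
Qed.

Lemma poly_head_tail A : A = (A`_0)%:P + drop_poly 1 A * 'X.
Proof.
rewrite -{1}[A](poly_take_drop 1) expr1; congr (_ + _).
by apply/polyP => -[|i]; rewrite coef_take_poly coefC.
Qed.

(** Substituting a series without constant term cannot lower the order. *)
Lemma eqX_comp n A B C : eqX n A B -> eqX n (A \Po ('X * C)) (B \Po ('X * C)).
Proof.
case=> D ->; rewrite comp_polyD comp_polyM comp_Xn_poly exprMn.
by exists (C ^+ n * (D \Po ('X * C))); rewrite !mulrA.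
Qed.

Lemma trunc_inverse N (u : {poly f}) : exists w, eqX N ((1 + 'X * u) * w) 1.
Proof.
exists (\sum_(i < N) (- ('X * u)) ^+ i).
have E := subrX1 (- ('X * u)) N.
exists (- (- u) ^+ N).
have -> : (1 + 'X * u) * \sum_(i < N) (- ('X * u)) ^+ i = - ((- ('X * u)) ^+ N - 1).
  by rewrite E; ring.
by rewrite -[- ('X * u)]mulrN exprMn; ring.
Qed.

(** The coefficient of t^N in F is the residue of F t^(-N-1) dt, and the
    substitution t -> t v turns it into the left-hand side, w standing for 1/v.
    For the monomials F = t^(N-r) the claim reads
    res (v^(-r-1) (tv)' t^(-r-1)) = 0 when r > 0: up to the factor -1/r the
    differential is exact, namely that of (tv)^(-r).  The division by r
    uses N < p. *)
Lemma residue_change_of_variable p N (F v w : {poly f}) :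
    p \in [pchar f] -> (N < p)%N -> eqX N.+1 (v * w) 1 ->
  ((F \Po ('X * v)) * ('X * v)^`() * w ^+ N.+1)`_N = F`_N.
Proof.
move=> pch ltNp vw.
have key r : (r <= N)%N -> (w ^+ r.+1 * ('X * v)^`())`_r = (r == 0%N)%:R.
  move=> lerN; rewrite derivM derivX mul1r mulrDr.
  have E1 : eqX N.+1 (w ^+ r.+1 * v) (w ^+ r).
    have [C E] := vw; exists (w ^+ r * C).
    by rewrite exprSr -mulrA [w * v]mulrC E; move: (w ^+ r) ('X^_) => a b; ring.
  rewrite coefD (eqX_coef E1) ?ltnS //.
  case: r lerN E1 => [|r] lerN E1.
    by rewrite !expr0 coef1 /= mulrC -mulrA coefXM addr0.
  have r0 : (r.+1%:R : f) != 0.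
    rewrite -(dvdn_pcharf pch); apply/negP => /(dvdn_leq (ltn0Sn r)).
    by rewrite leqNgt (leq_ltn_trans lerN ltNp).
  apply: (mulfI r0); rewrite mulr0.
  have [C E] := vw.
  (* v' w = - v w' up to terms of high order, by differentiating v w = 1. *)
  have E3 : eqX N.+1 (w ^+ r.+2 * ('X * v^`())) (- ('X * (w ^+ r * w^`()))).
    have [D /eqP ED] : exists D, 'X * (v^`() * w + v * w^`()) = 'X^(N.+1) * D.
      move/(congr1 deriv): (E).
      rewrite derivM derivD derivC add0r derivM derivXn /= => ->.
      by exists (N.+1%:R * C + 'X * C^`()); rewrite exprS -['X^N *+ _]mulr_natl;
        move: (N.+1%:R : {poly f}) 'X^N => a b; ring.
    exists (w ^+ r.+1 * D - C * ('X * (w ^+ r * w^`()))).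
    rewrite mulrBr [_ * (w ^+ _ * D)]mulrCA -(eqP ED) [_ * (C * _)]mulrA.
    have -> : 'X^(N.+1) * C = v * w - 1 by rewrite E [1 + _]addrC addrK.
    by rewrite !exprS; move: (w ^+ r) => wr; ring.
  rewrite (eqX_coef E3) ?ltnS // coefN coefXM /=.
  have := coef_deriv (w ^+ r.+1) r; rewrite deriv_exp /= coefMn.
  by rewrite [w ^+ r * _]mulrC mulrDr mulrN !mulr_natl => ->; rewrite subrr.
rewrite {1}comp_polyE !mulr_suml coef_sum.
have term k : ((F`_k *: ('X * v) ^+ k) * ('X * v)^`() * w ^+ N.+1)`_N = F`_k *+ (k == N).
  rewrite -!scalerAl coefZ exprMn -!mulrA coefXnM.
  case: leqP => [lekN|ltNk]; last by rewrite mulr0 gtn_eqF.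
  have E : eqX N.+1 (v ^+ k * (('X * v)^`() * w ^+ N.+1)) (w ^+ (N - k).+1 * ('X * v)^`()).
    have -> : w ^+ N.+1 = w ^+ k * w ^+ (N - k).+1 by rewrite -exprD addnS subnKC.
    have [C EC] := eqXX k vw; exists (w ^+ (N - k).+1 * ('X * v)^`() * C).
    rewrite exprMn expr1n in EC.
    transitivity ((v ^+ k * w ^+ k) * (w ^+ (N - k).+1 * ('X * v)^`()));
      first by move: (v ^+ k) (w ^+ k) (w ^+ _) => a b c; ring.
    by rewrite EC; move: ('X^_) (w ^+ _) => a b; ring.
  rewrite (eqX_coef E) ?ltnS ?leq_subr // key ?leq_subr //.
  by rewrite subn_eq0 [k == N]eqn_leq lekN /= mulr_natr.
case: (ltnP N (size F)) => [ltN|leN].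
  rewrite (bigD1 (Ordinal ltN)) //= term eqxx big1 ?addr0 // => i ne.
  by rewrite term (_ : _ == _ = false) //; exact: negPf ne.
rewrite nth_default // big1 // => i _; rewrite term.
by rewrite ltn_eqF // (leq_trans (ltn_ord i)).
Qed.

(** The quadratic differential H t^(-n-2) dt^2 is carried by t -> t v to
    H' t^(-n-2) dt^2, where H' is this polynomial; w stands for 1/v. *)
Definition qdiff_pullback (n : nat) (v w H : {poly f}) : {poly f} :=
  ('X * v)^`() ^+ 2 * (H \Po ('X * v)) * w ^+ n.+2.

Lemma eqX_comp_right n (F A B : {poly f}) :
  eqX n A B -> eqX n (F \Po A) (F \Po B).
Proof.
move=> AB; elim/poly_ind: F => [|F c IH].
  by rewrite !comp_poly0; apply: eqX_refl.
rewrite !comp_poly_MXaddC; have [C ->] := eqXM IH AB.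
by exists C; rewrite addrAC.
Qed.

(** A = 1 + a X^j + O(X^(j+1)).  Under multiplication the parameters a add up,
    which gives the first-order term of [qdiff_pullback] at once. *)
Definition unit_jet j (a : f) A := eqX j.+1 A (1 + a *: 'X^j).

Lemma unit_jetM j a b A B : (0 < j)%N -> unit_jet j a A -> unit_jet j b B ->
  unit_jet j (a + b) (A * B).
Proof.
move=> j0 hA hB; apply: eqX_trans (eqXM hA hB) _.
case: j j0 {hA hB} => // j _; exists ((a * b) *: 'X^j).
rewrite -!mul_polyC polyCD polyCM !exprS; move: 'X^j => x; ring.
Qed.

Lemma unit_jetX j a A k : (0 < j)%N -> unit_jet j a A -> unit_jet j (k%:R * a) (A ^+ k).
Proof.
move=> j0 hA; elim: k => [|k IH].
  by rewrite mul0r expr0 /unit_jet scale0r addr0; apply: eqX_refl.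
by rewrite exprS mulrS mulrDl mul1r; apply: unit_jetM.
Qed.

Lemma unit_jetV j a N v w : (0 < j < N)%N -> unit_jet j a v -> eqX N (v * w) 1 ->
  unit_jet j (- a) w.
Proof.
move=> /andP[j0 ltjN] hv /(eqX_le ltjN) vw.
have hV : unit_jet j (- a) (1 + (- a) *: 'X^j) by apply: eqX_refl.
have := unit_jetM j0 hv hV; rewrite subrr /unit_jet scale0r addr0 => h1.
have : eqX j.+1 (v * w * (1 + (- a) *: 'X^j)) (1 + (- a) *: 'X^j).
  by rewrite -[X in eqX _ _ X]mul1r; apply: eqXl.
apply: eqX_trans; rewrite -[X in eqX _ X _]mulr1 [v * w]mulrC -mulrA.
exact/eqXr/eqX_sym.
Qed.

Lemma unit_jet_deriv j a v : unit_jet j a v -> unit_jet j (j.+1%:R * a) ('X * v)^`().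
Proof.
case=> C ->; exists (j.+2%:R * C + 'X * C^`()).
have -> : 'X * (1 + a *: 'X^j + 'X^(j.+1) * C) =
  'X + a *: 'X^(j.+1) + 'X^(j.+2) * C by rewrite -!mul_polyC !exprS; move: 'X^j => x; ring.
rewrite !derivE /= -!mul_polyC polyCM polyC_natr -['X^j *+ _]mulr_natl -['X^(j.+1) *+ _]mulr_natl.
by rewrite !exprS; move: 'X^j (j.+1%:R) (j.+2%:R) => x c d; ring.
Qed.

(** The three factors of the pullback contribute 2 (j + 1), 0 and - (n + 2) to
    the coefficient of a.  Its vanishing for n = 2 j is the only obstruction to
    moving the coordinates one at a time: it is what separates the parities of
    n, and it makes the action of G_(m+1)
    trivial on L_(m+1,2m+3)^*. *)
Lemma qdiff_pullback_jet n j a N v w H : (0 < j < N)%N -> unit_jet j a v ->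
    eqX N (v * w) 1 ->
  eqX j.+1 (qdiff_pullback n v w H)
    (H + (a * ((2 * j)%:R - n%:R) * H`_0) *: 'X^j).
Proof.
move=> jN hv vw; have [j0 _] := andP jN.
have E1 := unit_jetM j0 (unit_jetX 2 j0 (unit_jet_deriv hv))
  (unit_jetX n.+2 j0 (unit_jetV jN hv vw)).
have E2 : eqX j.+1 (H \Po ('X * v)) H.
  rewrite -[X in eqX _ _ X]comp_polyXr; apply: eqX_comp_right.
  have [C ->] := hv; exists (a%:P + 'X * C).
  by rewrite -mul_polyC !exprS; move: 'X^j => x; ring.
rewrite /qdiff_pullback mulrAC.
apply: eqX_trans (eqXM E1 E2) _.
rewrite mulrDl mul1r; set b := (X in X *: 'X^j).
have -> : a * ((2 * j)%:R - n%:R) * H`_0 = b * H`_0.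
  congr (_ * _); rewrite /b !mulrS natrM; ring.
exists (b *: drop_poly 1 H).
rewrite {2}(poly_head_tail H) -!mul_polyC polyCM !exprS.
by move: 'X^j (H`_0)%:P (drop_poly _ _) => x h d; ring.
Qed.

(** When n = 2 K, a square root of a quadratic differential is an ordinary
    differential with a pole of order K + 1, and it is pulled back as such. *)
Lemma qdiff_pullback_sqrt K c v w S H :
  eqX K.+1 (c *: S ^+ 2) H ->
  eqX K.+1 (c *: (('X * v)^`() * (S \Po ('X * v)) * w ^+ K.+1) ^+ 2)
    (qdiff_pullback (2 * K) v w H).
Proof.
move/(eqX_comp v) => E.
have -> : c *: (('X * v)^`() * (S \Po ('X * v)) * w ^+ K.+1) ^+ 2 =
   qdiff_pullback (2 * K) v w (c *: S ^+ 2).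
  rewrite /qdiff_pullback comp_polyZ rmorphXn /= -scalerAr -scalerAl.
  by congr (_ *: _); rewrite (_ : (2 * K).+2 = K.+1 * 2)%N ?exprM; [ring | lia].
by apply/eqXl/eqXr.
Qed.

End Congruence.

(** * Vector fields, their dual, and the action of automorphisms *)

Section W1.
Variables (f : fieldType) (p : nat).
Hypothesis pch : p \in [pchar f].

Let p_pr : prime p. Proof. by have /andP[] := pch. Qed.
Let p_gt1 : (1 < p)%N. Proof. exact: prime_gt1. Qed.
Let p_gt0 : (0 < p)%N. Proof. exact: prime_gt0. Qed.

Local Notation tr := (in_qpoly ('X^p : {poly f})).

Implicit Types A B C Q b : {poly f}.

Lemma mk_monic_Xp : mk_monic ('X^p : {poly f}) = 'X^p.
Proof. by rewrite mk_monic_Xn prednK. Qed.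

Lemma size_trunc (q : trunc f p) : (size (q : {poly f}) <= p)%N.
Proof. by apply: leq_trans (size_npoly q) _; rewrite mk_monic_Xp size_polyXn. Qed.

Lemma tr_eqX A : eqX p (tr A : {poly f}) A.
Proof.
apply: eqX_sym; exists (Pdiv.Ring.rdivp A (mk_monic 'X^p)).
have := Pdiv.RingMonic.rdivp_eq (monic_mk_monic ('X^p : {poly f})) A.
by rewrite {2}mk_monic_Xp => {1}->; rewrite addrC mulrC.
Qed.

Lemma eqX_trunc (q r : trunc f p) : eqX p (q : {poly f}) r -> q = r.
Proof.
move=> h; apply/npolyP => i; case: (ltnP i p) => [lt|ge].
  exact: eqX_coef h lt.
by rewrite !nth_default // (leq_trans (size_trunc _)).
Qed.

Lemma eqX_tr A B : eqX p A B -> tr A = tr B.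
Proof.
move=> h; apply: eqX_trunc; apply: eqX_trans (tr_eqX A) _.
exact/(eqX_trans h)/eqX_sym/tr_eqX.
Qed.

Lemma tr_inj A B : tr A = tr B -> eqX p A B.
Proof.
move=> E; apply: eqX_trans (tr_eqX B); rewrite -E; exact/eqX_sym/tr_eqX.
Qed.

Lemma trK (q : trunc f p) : tr q = q.
Proof. by apply: eqX_trunc; apply: tr_eqX. Qed.

(** The derivative passes to the quotient by X^p because the characteristic
    is p. *)
Lemma eqX_deriv A B : eqX p A B -> eqX p A^`() B^`().
Proof.
case=> C ->; exists C^`(); rewrite derivD derivM derivXn -mulr_natl.
by rewrite -polyC_natr (pcharf0 pch) polyC0 !mul0r add0r.
Qed.

(** The derivation b d/dt; each of the L_n consists of those with b divisible
    by t^(n+1). *)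
Definition vfield (b : {poly f}) : 'End(trunc f p) :=
  linfun (fun q : trunc f p => tr (b * (q : {poly f})^`())).

Lemma vfieldE b (q : trunc f p) : vfield b q = tr (b * (q : {poly f})^`()).
Proof.
pose h := fun q : trunc f p => tr (b * (q : {poly f})^`()) : trunc f p.
have hlin : linear h.
  by move=> a u v; rewrite /h /= derivD derivZ mulrDr -scalerAr linearP.
pose H := GRing.isLinear.Build _ _ _ _ h hlin.
pose hL : {linear _ -> _} := HB.pack h H.
exact: (lfunE hL).
Qed.

Lemma vfield_tr b Q : vfield b (tr Q) = tr (b * Q^`()).
Proof. by rewrite vfieldE; apply/eqX_tr/eqXr/eqX_deriv/tr_eqX. Qed.

Lemma vfield_is_linear : linear vfield.
Proof.
by move=> a b c; apply/lfunP => q; rewrite add_lfunE scale_lfunE !vfieldE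
  mulrDl -scalerAl linearP.
Qed.

HB.instance Definition _ := GRing.isLinear.Build _ _ _ _ vfield vfield_is_linear.

Lemma vfield_eqX b c : eqX p b c -> vfield b = vfield c.
Proof. by move=> h; apply/lfunP => q; rewrite !vfieldE; apply/eqX_tr/eqXl. Qed.

Lemma lder_vfield i : lder f p i = vfield 'X^(i.+1).
Proof. by apply/lfunP => q; rewrite lderE vfieldE rmorphM rmorphXn. Qed.

(** [take_poly m.+1 b] collects the part of b that has no coordinate on
    l_m, ..., l_(p-2). *)
Lemma eqX_sum_Xn m b : eqX p b
  (take_poly m.+1 b + \sum_(m <= i < p.-1) b`_i.+1 *: 'X^(i.+1)).
Proof.
apply: coef_eqX => i lt_ip; rewrite coefD coef_take_poly coef_sum.
under eq_bigr do rewrite coefZ coefXn.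
case: i lt_ip => [|i] lt_ip /=.
  by rewrite big1 ?addr0 // => j _; rewrite mulr0.
rewrite (eq_bigr (fun j => if j == i then b`_i.+1 else 0)) => [|j _]; last first.
  by rewrite eqSS eq_sym; case: eqP => [->|]; rewrite ?mulr1 ?mulr0.
rewrite -big_mkcond big_nat1_eq ltn_predRL lt_ip andbT ltnS.
by case: ltnP; rewrite ?addr0 ?add0r.
Qed.

Lemma lder_X i : (i < p.-1)%N -> (lder f p i (tr 'X) : {poly f}) = 'X^(i.+1).
Proof.
move=> lt_ip; rewrite lder_vfield vfield_tr derivX mulr1 in_qpoly_small //.
by rewrite mk_monic_Xp !size_polyXn ltnS -ltn_predRL.
Qed.

Lemma vfield_sum m b : eqX m.+1 b 0 ->
  vfield b = \sum_(m <= i < p.-1) b`_i.+1 *: lder f p i.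
Proof.
move=> b0; rewrite (vfield_eqX (eqX_sum_Xn m b)).
have -> : take_poly m.+1 b = 0.
  apply/polyP => i; rewrite coef_take_poly coef0; case: ifP => // /(eqX_coef b0) ->.
  by rewrite coef0.
rewrite add0r linear_sum; apply: eq_bigr => i _.
by rewrite linearZ lder_vfield.
Qed.

Lemma LsubP n x : reflect (exists b, x = vfield ('X^(n.+1) * b)) (x \in Lsub f p n).
Proof.
apply: (iffP idP) => [|[b ->]].
  rewrite /Lsub; set s := map _ _ => /(coord_span (X := in_tuple s)) ->.
  exists (\sum_i coord (in_tuple s) i x *: 'X^i).
  rewrite mulr_sumr linear_sum; apply: eq_bigr => i _.
  rewrite -scalerAr linearZ /= -exprD addSn -lder_vfield.
  have := ltn_ord i; rewrite {2}size_map size_iota => lti.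
  by rewrite (nth_map 0%N) ?size_iota // nth_iota.
rewrite (vfield_sum (m := n)); last by exists b; rewrite add0r.
rewrite big_nat; apply: memv_suml => i /andP[leni ltip]; apply/memvZ/memv_span/map_f.
by rewrite mem_iota leni subnKC // ltnW // (leq_ltn_trans leni).
Qed.

Lemma lder_Lsub m i : (m <= i)%N -> lder f p i \in Lsub f p m.
Proof.
move=> le_mi; apply/LsubP; exists 'X^(i - m).
by rewrite lder_vfield -exprD addSn subnKC.
Qed.

Section Dual.
Variable m : nat.
Implicit Types lam mu : Ldual f p m.
Local Notation L := (Lsub f p m).

Lemma lam_vfield lam b : eqX m.+1 b 0 ->
  lam (vsproj L (vfield b)) = \sum_(m <= i < p.-1) b`_i.+1 * ell i lam.
Proof.
move=> /vfield_sum ->; rewrite !linear_sum; apply: eq_bigr => i _.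
by rewrite !linearZ.
Qed.

Lemma Ldual_ext lam mu :
  (forall i, (m <= i < p.-1)%N -> ell i lam = ell i mu) -> lam = mu.
Proof.
move=> h; apply/lfunP => x; rewrite -[x]vsvalK.
have /LsubP[b ->] := subvsP x.
have b0 : eqX m.+1 ('X^(m.+1) * b) 0 by exists b; rewrite add0r.
rewrite !lam_vfield // !big_nat; apply: eq_bigr => i /h -> //.
Qed.

Lemma LquodualP n lam : (m <= n)%N ->
  Lquodual f p m n lam <-> (forall i, (n <= i < p.-1)%N -> ell i lam = 0).
Proof.
move=> le_mn; split=> [h i /andP[le_ni lt_ip]|h x].
  apply: h; rewrite vsprojK ?lder_Lsub //; exact: leq_trans le_ni.
move=> /LsubP[b xE]; rewrite -[x]vsvalK xE lam_vfield; last first.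
  by exists ('X^(n - m) * b); rewrite add0r mulrA -exprD addSn subnKC.
rewrite big_nat big1 // => i /andP[le_mi lt_ip].
case: (ltnP i n) => [lt_in|le_ni]; last by rewrite h ?mulr0 // le_ni.
by rewrite coefXnM ltnS lt_in mul0r.
Qed.

Definition dual_of_coords (c : nat -> f) : Ldual f p m :=
  linfun (fun x : subvs_of L =>
    \sum_(m <= i < p.-1) (vsval x (tr 'X) : {poly f})`_i.+1 * c i : f^o).

Lemma dual_of_coordsE c x : dual_of_coords c x =
  \sum_(m <= i < p.-1) (vsval x (tr 'X) : {poly f})`_i.+1 * c i.
Proof.
pose h := fun x : subvs_of L =>
  (\sum_(m <= i < p.-1) (vsval x (tr 'X) : {poly f})`_i.+1 * c i) : f^o.
have hlin : linear h.
  move=> a u v; rewrite /h scaler_sumr -big_split /=; apply: eq_bigr => i _.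
  rewrite add_lfunE scale_lfunE /= coefD coefZ mulrDl.
  by rewrite -mulrA.
pose H := GRing.isLinear.Build _ _ _ _ h hlin.
pose hL : {linear _ -> _} := HB.pack h H.
exact: (lfunE hL).
Qed.

Lemma ell_dual_of_coords c i : (m <= i < p.-1)%N -> ell i (dual_of_coords c) = c i.
Proof.
move=> /andP[le_mi lt_ip]; rewrite /ell dual_of_coordsE vsprojK ?lder_Lsub //.
rewrite lder_X //.
rewrite (eq_bigr (fun j => if j == i then c i else 0)) => [|j _]; last first.
  by rewrite coefXn eqSS; case: eqP => [->|]; rewrite ?mul1r ?mul0r.
by rewrite -big_mkcond big_nat1_eq le_mi lt_ip.
Qed.

(** The numerator of the quadratic differential
    (ell_n t^(-n-2) + ... + ell_m t^(-m-2)) dt^2.  A functional vanishing on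
    L_(n+1) is the residue pairing of vector fields with it, as
    [qdiff_pairing] shows. *)
Definition qdiff n lam : {poly f} := \poly_(j < (n - m).+1) ell (n - j) lam.

Lemma qdiff_pairing n lam b : (m <= n < p.-1)%N -> Lquodual f p m n.+1 lam ->
  eqX m.+1 b 0 -> lam (vsproj L (vfield b)) = (b * qdiff n lam)`_n.+1.
Proof.
move=> /andP[le_mn lt_np] /LquodualP h b0; rewrite lam_vfield //.
rewrite (big_cat_nat (n := n.+1)) //=; last exact: leqW.
rewrite [X in _ + X]big_nat [X in _ + X]big1 ?addr0; last first.
  by move=> i hi; rewrite h ?mulr0 // leqW.
rewrite -{1}[m]add0n big_addn big_nat_rev /= add0n subSn // big_mkord.
rewrite /qdiff poly_def mulr_sumr coef_sum; apply: eq_bigr => j _.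
have := ltn_ord j; rewrite ltnS => le_j.
rewrite -scalerAr coefZ coefMXn ltnNge (leq_trans le_j) ?leqW ?leq_subr //= mulrC.
by congr (ell _ _ * b`_ _); lia.
Qed.

End Dual.

Section Automorphisms.
Implicit Types (g h : 'End(trunc f p)) (v w th : {poly f}).

(** g is the substitution t -> t v; v is a polynomial rather than a class, so
    that derivatives and compositions make sense before truncation. *)
Definition acts_by g v := forall Q, g (tr Q) = tr (Q \Po ('X * v)).

Lemma trunc_morphE g psi : monoid_morphism g -> g (tr 'X) = tr psi ->
  forall Q, g (tr Q) = tr (Q \Po psi).
Proof.
move=> [g1 gM] gX; elim/poly_ind => [|Q c IH].
  by rewrite comp_poly0 !linear0.
rewrite comp_poly_MXaddC !linearD /= rmorphM gM IH gX rmorphM; congr (_ + _).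
by rewrite -[c%:P]alg_polyC !linearZ /= rmorph1 g1.
Qed.

Lemma aut_invK g : is_aut g -> cancel g (g^-1)%VF /\ cancel (g^-1)%VF g.
Proof.
case=> bij_g _; have k0 : lker g == 0%VS by apply/lker0P/bij_inj.
by split; [exact: lker0_lfunK | move=> x; rewrite lker0_lfunVK].
Qed.

Lemma aut_inv_morph g : is_aut g -> monoid_morphism (g^-1)%VF.
Proof.
move=> ag; have [gK gVK] := aut_invK ag; case: (ag) => _ [g1 gM].
split=> [|x y]; first by rewrite -g1 gK.
by rewrite -{1}[x]gVK -{1}[y]gVK -gM gK.
Qed.

Lemma GsubP m g : Gsub f p m g -> exists u, acts_by g (1 + 'X^m * u).
Proof.
case=> -[_ gmorph] [u gX]; exists (u : {poly f}); apply: trunc_morphE => //.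
by rewrite gX -{1}[u]trK -rmorphXn -rmorphM -rmorphD mulrDr mulr1 mulrA -exprS.
Qed.

(** A substitution tangent to the identity preserves the order of vanishing
    at 0, so that its kernel is trivial. *)
Lemma acts_by_inj g v : v`_0 = 1 -> acts_by g v -> injective g.
Proof.
move=> v0 gv; suff: forall q, g q = 0 -> q = 0 by exact: raddf_inj.
move=> q; rewrite -[q]trK gv -[0](rmorph0 (in_qpoly _)).
move=> /tr_inj h; apply: eqX_tr.
suff H k : (k <= p)%N -> eqX k (q : {poly f}) 0 by exact: H.
elim: k => [|k IH] lt_kp; first by exists q; rewrite expr0 mul1r add0r.
have [r qE] := IH (ltnW lt_kp); rewrite add0r in qE.
have r0 : r`_0 = 0.
  have := eqX_coef h lt_kp; rewrite coef0 qE comp_polyM comp_Xn_poly exprMn.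
  rewrite -mulrA coefXnM ltnn subnn -!horner_coef0 hornerM horner_exp.
  by rewrite [v.[0]]horner_coef0 v0 expr1n mul1r horner_comp hornerM hornerX mul0r.
exists (drop_poly 1 r); rewrite add0r qE {1}(poly_head_tail r) r0 exprS.
by rewrite polyC0; move: 'X^k (drop_poly _ _) => x d; ring.
Qed.

Definition subst_aut v : 'End(trunc f p) :=
  linfun (fun q : trunc f p => tr ((q : {poly f}) \Po ('X * v))).

Lemma subst_autE v q : subst_aut v q = tr ((q : {poly f}) \Po ('X * v)).
Proof.
pose h := fun q : trunc f p => tr ((q : {poly f}) \Po ('X * v)) : trunc f p.
have hlin : linear h.
  by move=> a u u'; rewrite /h /= comp_polyD comp_polyZ linearP.
pose H := GRing.isLinear.Build _ _ _ _ h hlin.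
pose hL : {linear _ -> _} := HB.pack h H.
exact: (lfunE hL).
Qed.

Lemma acts_by_subst_aut v : acts_by (subst_aut v) v.
Proof. by move=> Q; rewrite subst_autE; apply/eqX_tr/eqX_comp/tr_eqX. Qed.

Lemma Gsub_subst_aut m u : (0 < m)%N ->
  Gsub f p m (subst_aut (1 + 'X^m * u)).
Proof.
move=> m0; set v := 1 + _; have gv := acts_by_subst_aut v; split; last first.
  exists (tr u); rewrite gv comp_polyX -rmorphXn -rmorphM -rmorphD.
  by rewrite mulrDr mulr1 mulrA -exprS.
split.
  have v0 : v`_0 = 1 by rewrite coefD coef1 coefXnM m0 addr0.
  have k0 : lker (subst_aut v) == 0%VS by apply/lker0P/(acts_by_inj v0 gv).
  exists (subst_aut v)^-1%VF; first exact: lker0_lfunK.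
  by move=> x; rewrite lker0_lfunVK.
split=> [|x y]; first by rewrite -[1](rmorph1 (in_qpoly _)) gv -polyC1 comp_polyC.
by rewrite -[x]trK -[y]trK -rmorphM !gv comp_polyM rmorphM.
Qed.

(** The inverse substitution psi also fixes the origin: psi (t v) = t, and the
    constant term of the left-hand side is that of psi. *)
Lemma aut_inv_acts g v : is_aut g -> acts_by g v -> exists th, acts_by (g^-1)%VF th.
Proof.
move=> ag gv; have [gK gVK] := aut_invK ag.
set psi : {poly f} := (g^-1)%VF (tr 'X).
have E : (g^-1)%VF (tr 'X) = tr psi by rewrite trK.
exists (drop_poly 1 psi); rewrite /acts_by.
suff -> : 'X * drop_poly 1 psi = psi by apply: trunc_morphE (aut_inv_morph ag) E.
have := gVK (tr 'X); rewrite E gv => /tr_inj /eqX_coef /(_ p_gt0).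
rewrite -!horner_coef0 horner_comp hornerM hornerX mul0r => psi0.
by rewrite [RHS]poly_head_tail -horner_coef0 psi0 add0r mulrC.
Qed.

(** Conjugation by a substitution phi multiplies the coefficient of a vector
    field by phi' and then applies the inverse substitution; this is the chain
    rule. *)
Lemma conj_vfield g v a : is_aut g -> acts_by g v ->
  (g^-1 \o (vfield a \o g))%VF =
  vfield ((g^-1)%VF (tr (a * ('X * v)^`())) : trunc f p).
Proof.
move=> ag gv; have [gK gVK] := aut_invK ag; have [_ hM] := aut_inv_morph ag.
apply/lfunP => q; rewrite -[q]trK !comp_lfunE gv !vfield_tr deriv_comp.
rewrite mulrCA mulrC in_qpolyM hM -gv gK.
by rewrite [RHS]in_qpolyM; congr (_ * _); apply/esym/trK.
Qed.

Lemma conj_vfield_order g v a m : is_aut g -> acts_by g v -> (m < p)%N ->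
  eqX m.+1 a 0 ->
  eqX m.+1 ((g^-1)%VF (tr (a * ('X * v)^`())) : trunc f p) 0.
Proof.
move=> ag gv lt_mp [b ->]; have [th gth] := aut_inv_acts ag gv.
rewrite gth add0r -mulrA comp_polyM comp_Xn_poly exprMn.
apply: eqX_trans (eqX_le lt_mp (tr_eqX _)) _.
by rewrite -mulrA; eexists; rewrite add0r.
Qed.

Lemma conj_Lsub g m v x : is_aut g -> acts_by g v -> (m < p)%N ->
  x \in Lsub f p m -> (g^-1 \o (x \o g))%VF \in Lsub f p m.
Proof.
move=> ag gv lt_mp /LsubP[b ->]; rewrite (conj_vfield _ ag gv).
have [|c ->] := @conj_vfield_order g v ('X^(m.+1) * b) m ag gv lt_mp.
  by exists b; rewrite add0r.
by rewrite add0r; apply/LsubP; exists c.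
Qed.

(** The co-adjoint action is the pullback of quadratic differentials: the
    residue pairing of g^-1 x g with qdiff is, by the change of variable,
    the pairing of x with the pullback. *)
Lemma ell_coad m n g v w (lam : Ldual f p m) i : is_aut g -> acts_by g v ->
    eqX p (v * w) 1 -> (m <= n < p.-1)%N -> Lquodual f p m n.+1 lam ->
    (m <= i < p.-1)%N ->
  ell i (coad g lam) =
    if (i <= n)%N then (qdiff_pullback n v w (qdiff n lam))`_(n - i) else 0.
Proof.
move=> ag gv vw hn hlam /andP[le_mi lt_ip]; have [gK gVK] := aut_invK ag.
have [le_mn lt_np] := andP hn.
have lt_np' : (n.+1 < p)%N by rewrite -ltn_predRL.
have lt_mp : (m < p)%N by apply: leq_ltn_trans le_mn _; exact: ltnW.
rewrite {1}/ell coadE vsprojK ?lder_Lsub // lder_vfield (conj_vfield _ ag gv).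
set b := (g^-1)%VF _.
rewrite (qdiff_pairing hn hlam); last first.
  apply: (conj_vfield_order ag gv lt_mp).
  by exists 'X^(i - m); rewrite add0r -exprD addSn subnKC.
rewrite -(residue_change_of_variable _ pch lt_np' (eqX_le lt_np' vw)).
have Eb : eqX p ((b : {poly f}) \Po ('X * v)) ('X^(i.+1) * ('X * v)^`()).
  by apply: tr_inj; rewrite -gv trK gVK.
have E : eqX p (((b : {poly f}) * qdiff n lam \Po ('X * v)) * ('X * v)^`() * w ^+ n.+2)
   ('X^(i.+1) * qdiff_pullback n v w (qdiff n lam)).
  rewrite comp_polyM; have [C ->] := Eb.
  exists (C * (qdiff n lam \Po 'X * v) * ('X * v)^`() * w ^+ n.+2).
  rewrite /qdiff_pullback; move: (w ^+ _) ('X^_) ('X^_) => a b' c; ring.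
by rewrite (eqX_coef E lt_np') coefXnM ltnS subSS; case: ltnP.
Qed.

End Automorphisms.

End W1.

(** * Orbits in coordinates *)

Section Orbits.
Variables (f : fieldType) (p : nat).
Hypothesis pch : p \in [pchar f].
Let p_gt1 : (1 < p)%N. Proof. by have /andP[/prime_gt1] := pch. Qed.

Local Notation tr := (in_qpoly ('X^p : {poly f})).
Implicit Types g h : 'End(trunc f p).

Lemma is_aut_comp g h : is_aut g -> is_aut h -> is_aut (g \o h)%VF.
Proof.
case=> -[g' gK gVK] [g1 gM] [[h' hK hVK] [h1 hM]]; split.
  by exists (h' \o g') => x; rewrite !comp_lfunE /= ?gK ?hVK.
by split=> [|x y]; rewrite !comp_lfunE ?h1 ?g1 // hM gM.
Qed.

Lemma is_aut_id : is_aut (\1%VF : 'End(trunc f p)).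
Proof.
split; first by exists id => x; rewrite id_lfunE.
by split=> [|x y]; rewrite !id_lfunE.
Qed.

Lemma Gsub_id m : Gsub f p m \1%VF.
Proof.
by split; [exact: is_aut_id | exists 0; rewrite id_lfunE mulr0 addr0].
Qed.

Lemma Gsub_le m n : (m <= n)%N -> Gsub f p n `<=` Gsub f p m.
Proof.
move=> le_mn g [ag [u gX]]; split=> //; exists (tr 'X ^+ (n - m) * u).
by rewrite mulrA -exprD addSn subnKC.
Qed.

Lemma Gsub_comp m g h : Gsub f p m g -> Gsub f p m h -> Gsub f p m (g \o h)%VF.
Proof.
move=> [ag [u gX]] [ah [v hX]]; split; first exact: is_aut_comp.
have [_ [g1 gM]] := ag.
have gXn k y : g (y ^+ k) = g y ^+ k.
  by elim: k => [|k IH]; rewrite ?expr0 ?g1 // !exprS gM IH.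
exists (u + (1 + tr 'X ^+ m * u) ^+ m.+1 * g v).
rewrite comp_lfunE hX linearD /= gM gXn gX.
have -> : tr 'X + tr 'X ^+ m.+1 * u = tr 'X * (1 + tr 'X ^+ m * u).
  by rewrite mulrDr mulr1 mulrA -exprS.
rewrite exprMn; set x := tr 'X; rewrite [x ^+ m.+1]exprS.
by move: (x ^+ m) => z; move: (_ ^+ m.+1) => y; ring.
Qed.

(** The quotient G_mn and G_m have the same orbits, whatever n; this is
    why an orbit for n is also one for every larger index. *)
Lemma coad_orbitE m n (lam : Ldual f p m) : (m <= n)%N ->
  coad_orbit n lam = [set coad g lam | g in Gsub f p m].
Proof.
move=> le_mn; apply/seteqP; split=> mu.
  move=> [C [g Gg ->] [_ [h Gh <-] <-]]; exists (g \o h)%VF => //.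
  exact: Gsub_comp Gg (Gsub_le le_mn Gh).
move=> [g Gg <-]; exists [set (g \o h)%VF | h in Gsub f p n]; first by exists g.
by exists g => //; exists \1%VF; [exact: Gsub_id | rewrite comp_lfun1r].
Qed.

Lemma coad_comp m g h (lam : Ldual f p m) : (m < p)%N ->
  Gsub f p m g -> Gsub f p m h -> coad g (coad h lam) = coad (g \o h)%VF lam.
Proof.
move=> lt_mp Gg Gh; have [[ag _] [ah _]] := (Gg, Gh).
have [u gv] := GsubP pch Gg.
apply/lfunP => x; rewrite !coadE vsprojK ?(conj_Lsub pch ag gv) ?subvsP //.
congr (lam (vsproj _ _)); apply/lfunP => q; rewrite !comp_lfunE.
have [hK hVK] := aut_invK ah; have [gK gVK] := aut_invK ag.
have [ghK ghVK] := aut_invK (is_aut_comp ag ah).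
apply: (can_inj ghK); rewrite ghVK comp_lfunE hVK gVK //.
Qed.

Lemma coad_id m (lam : Ldual f p m) : coad \1%VF lam = lam.
Proof.
apply/lfunP => x; rewrite coadE -{2}[x]vsvalK; congr (lam (vsproj _ _)).
apply/lfunP => q; rewrite !comp_lfunE id_lfunE.
by have [K _] := aut_invK is_aut_id; rewrite -{2}[vsval x q]K id_lfunE.
Qed.

Section Coords.
Variables (m n : nat).
Hypotheses (m_gt0 : (0 < m)%N) (le_mn : (m <= n)%N) (lt_np : (n < p.-1)%N).
Implicit Types lam mu : Ldual f p m.

Lemma coef_qdiff lam i : (i <= n - m)%N -> (qdiff n lam)`_i = ell (n - i) lam.
Proof. by move=> le_i; rewrite coef_poly ltnS le_i. Qed.

Lemma Gsub_unit g : Gsub f p m g -> exists v w,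
  [/\ acts_by g v, eqX p (v * w) 1 & exists a, unit_jet m a v].
Proof.
move=> /(GsubP pch)[u gv]; have [w vw] := trunc_inverse p ('X^(m.-1) * u).
exists (1 + 'X^m * u), w; split=> //.
  by move: vw; rewrite mulrA -exprS prednK.
exists u`_0; exists (drop_poly 1 u).
rewrite {1}(poly_head_tail u) -mul_polyC exprS; move: 'X^m (u`_0)%:P (drop_poly _ _) => x h d.
ring.
Qed.

Lemma ell_coad_sub g v w lam i : Gsub f p m g -> acts_by g v ->
    eqX p (v * w) 1 -> Lquodual f p m n.+1 lam -> (i <= n - m)%N ->
  ell (n - i) (coad g lam) = (qdiff_pullback n v w (qdiff n lam))`_i.
Proof.
move=> [ag _] gv vw hlam le_i; rewrite (ell_coad pch ag gv vw (n := n)) //.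
- by rewrite leq_subr subKn // (leq_trans le_i) ?leq_subr.
- by rewrite le_mn.
by apply/andP; split; lia.
Qed.

Lemma Lquodual_coad g lam : Gsub f p m g -> Lquodual f p m n.+1 lam ->
  Lquodual f p m n.+1 (coad g lam).
Proof.
move=> Gg hlam; have [v [w [gv vw _]]] := Gsub_unit Gg; have [ag _] := Gg.
apply/(LquodualP pch); first exact: leqW.
move=> i /andP[lt_ni lt_ip]; rewrite (ell_coad pch ag gv vw (n := n)) ?le_mn //.
  by rewrite leqNgt lt_ni.
by rewrite lt_ip andbT ltnW // (leq_ltn_trans le_mn).
Qed.

(** An automorphism t -> t + a t^(j+1) + O(t^(j+2)) fixes the coordinates above
    ell_(n-j) and translates that one, by an arbitrary amount if
    ell_n is nonzero and n <> 2 j. *)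
Lemma coad_first_order g v j a lam : (0 < j < p)%N -> Gsub f p m g -> acts_by g v ->
    unit_jet j a v -> Lquodual f p m n.+1 lam ->
  (forall i, (i < j)%N -> (i <= n - m)%N ->
     ell (n - i) (coad g lam) = ell (n - i) lam) /\
  ((j <= n - m)%N -> ell (n - j) (coad g lam) =
     ell (n - j) lam + a * ((2 * j)%:R - n%:R) * ell n lam).
Proof.
move=> jp Gg gv hv hlam.
have [w vw] : exists w, eqX p (v * w) 1.
  have [C vE] := hv; have [w hw] := trunc_inverse p (a *: 'X^(j.-1) + 'X^j * C).
  exists w; suff <- : 1 + 'X * (a *: 'X^(j.-1) + 'X^j * C) = v by [].
  have /andP[j0 _] := jp.
  by rewrite vE mulrDr -scalerAr -exprS prednK // mulrA -exprS addrA.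
have E := qdiff_pullback_jet n (qdiff n lam) jp hv vw.
split=> [i lt_ij le_i|le_j]; rewrite (ell_coad_sub Gg gv vw) //.
  rewrite (eqX_coef E (leqW lt_ij)) coefD coefZ coefXn coef_qdiff //.
  by rewrite ltn_eqF // mulr0 addr0.
rewrite (eqX_coef E (ltnSn j)) coefD coefZ coefXn coef_qdiff //.
by rewrite eqxx mulr1 coef_qdiff // subn0.
Qed.

Lemma coad_top_coords g lam i : Gsub f p m g -> Lquodual f p m n.+1 lam ->
  (i < m)%N -> (i <= n - m)%N -> ell (n - i) (coad g lam) = ell (n - i) lam.
Proof.
move=> Gg hlam lt_im le_i; have [v [w [gv vw [a hv]]]] := Gsub_unit Gg.
by apply: (coad_first_order _ Gg gv hv hlam).1 => //; lia.
Qed.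

Lemma Lquodual_ext lam mu : Lquodual f p m n.+1 lam -> Lquodual f p m n.+1 mu ->
  (forall i, (i <= n - m)%N -> ell (n - i) lam = ell (n - i) mu) -> lam = mu.
Proof.
move=> /(LquodualP pch) hl /(LquodualP pch) hm h.
apply: (Ldual_ext pch) => i /andP[le_mi lt_ip]; case: (leqP i n) => [le_in|lt_ni].
  by rewrite -(subKn le_in) h // leq_sub2l.
by rewrite hl ?hm ?lt_ni ?lt_ip // leqW.
Qed.

(** Only ell_n, ..., ell_(n-m) are coordinates here, and [coad_first_order]
    with j = m leaves ell_(n-m) fixed as well: it is a coordinate only if
    n = 2 m. *)
Lemma coad_trivial g lam : (n <= 2 * m)%N -> Gsub f p m g ->
  Lquodual f p m n.+1 lam -> coad g lam = lam.
Proof.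
move=> le_n2m Gg hlam; apply: Lquodual_ext => //; first exact: Lquodual_coad.
have [v [w [gv vw [a hv]]]] := Gsub_unit Gg.
have mp : (0 < m < p)%N by lia.
have [E1 E2] := coad_first_order mp Gg gv hv hlam.
move=> i le_i; case: (ltnP i m) => [|le_mi]; first by move/E1; apply.
have im : i = m by lia.
have n2m : n = (2 * m)%N by lia.
rewrite im in le_i *; rewrite E2 // [X in _ - X%:R]n2m subrr mulr0.
by rewrite mul0r addr0.
Qed.

Lemma natr_sub_neq0 (a b : nat) : (a < b + p)%N -> (b < a + p)%N -> a <> b ->
  (a%:R - b%:R : f) != 0.
Proof.
wlog lt_ba : a b / (b < a)%N.
  move=> H ap bp ab; case: (ltngtP b a) => [lt|lt|E]; first exact: H.
    by rewrite -opprB oppr_eq0 H //; exact: nesym.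
  by case: ab.
move=> lt_ap _ _; rewrite -natrB 1?ltnW // -(dvdn_pcharf pch).
apply/negP => /dvdn_leq; rewrite subn_gt0 => /(_ lt_ba); lia.
Qed.

(** Two functionals with the same ell_n, ..., ell_(n-m+1) are made to agree one
    coordinate after the other, from the top down, by the automorphisms
    t -> t + a t^(j+1).  The last hypothesis covers the coordinate ell_K with
    n = 2 K, which no such automorphism moves: the agreement of the higher
    coordinates, after any g, has to force the agreement of this one. *)
Lemma coad_transitive lam mu : Lquodual f p m n.+1 lam -> Lquodual f p m n.+1 mu ->
    ell n lam != 0 ->
    (forall i, (i < m)%N -> (i <= n - m)%N -> ell (n - i) lam = ell (n - i) mu) ->
    (forall g K, Gsub f p m g -> n = (2 * K)%N -> (K <= n - m)%N ->
       (forall i, (i < K)%N -> ell (n - i) (coad g lam) = ell (n - i) mu) ->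
       ell K (coad g lam) = ell K mu) ->
  exists2 g, Gsub f p m g & coad g lam = mu.
Proof.
move=> hlam hmu l0.
have lt_mp : (m < p)%N by lia.
suff H d j : ((n - m).+1 - j <= d)%N -> (m <= j)%N -> forall lam,
  Lquodual f p m n.+1 lam -> ell n lam != 0 ->
  (forall i, (i < j)%N -> (i <= n - m)%N -> ell (n - i) lam = ell (n - i) mu) ->
  (forall g K, Gsub f p m g -> n = (2 * K)%N -> (K <= n - m)%N ->
       (forall i, (i < K)%N -> ell (n - i) (coad g lam) = ell (n - i) mu) ->
       ell K (coad g lam) = ell K mu) ->
  exists2 g, Gsub f p m g & coad g lam = mu.
  by move=> h1 h2; apply: (H ((n - m).+1 - m)%N m).
elim: d j {lam hlam l0} => [|d IH] j lt_d le_mj lam hlam l0 hj hK;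
  (case: (ltnP (n - m) j) => [lt_j|le_j];
    first by exists \1%VF; [exact: Gsub_id | rewrite coad_id; apply: Lquodual_ext => // i le_i;
      apply: hj => //; lia]); first by lia.
have lt_d' : ((n - m).+1 - j.+1 <= d)%N by lia.
have le_mj' : (m <= j.+1)%N by exact: leqW.
have [n2j|n2j] := eqVneq (2 * j)%N n.
  apply: (IH j.+1 lt_d' le_mj' lam) => // i.
  rewrite ltnS leq_eqVlt => /orP[/eqP->|lt_i] le_i.
    have -> : (n - j = j)%N by lia.
    have := hK \1%VF j (Gsub_id m) (esym n2j) le_j; rewrite coad_id; apply.
    by move=> i' lt_i'; apply: hj => //; lia.
  exact: hj.
(* The value of a solves the linear equation of [coad_first_order]. *)
pose a := (ell (n - j) mu - ell (n - j) lam) / (((2 * j)%:R - n%:R) * ell n lam).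
pose u : {poly f} := a *: 'X^(j - m).
have Gg := Gsub_subst_aut pch u m_gt0; have gv := acts_by_subst_aut pch (1 + 'X^m * u).
set g := subst_aut _ _ in Gg gv.
have hv : unit_jet j a (1 + 'X^m * u).
  by rewrite -scalerAr -exprD subnKC //; exact: eqX_refl.
have [|E1 E2] := coad_first_order _ Gg gv hv hlam; first by lia.
have l0' : ell n (coad g lam) = ell n lam.
  by have := E1 0%N; rewrite subn0; apply; lia.
have [||i|h K Gh nK leK|h Gh hE] := IH j.+1 lt_d' le_mj' (coad g lam).
- exact: Lquodual_coad.
- by rewrite l0'.
- rewrite ltnS leq_eqVlt => /orP[/eqP->|lt_i] le_i.
    rewrite E2 // /a -mulrA divfK; last first.
      rewrite mulf_neq0 // natr_sub_neq0 //; [lia|lia|exact/eqP].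
    by rewrite addrC subrK.
  by rewrite E1 // hj.
- rewrite (coad_comp _ lt_mp Gh Gg) => h'; apply: hK => //.
  exact: Gsub_comp.
exists (h \o g)%VF; first exact: Gsub_comp.
by rewrite -coad_comp.
Qed.

End Coords.

End Orbits.

(** * The polynomials P_mk *)

(** All that is needed about the recursive square root: rather than following
    the recursion, equalities between square roots are obtained from those
    between their squares. *)
Lemma sqrt_unique (R : idomainType) (s t : nat -> R) K : (2 : R) != 0 ->
    s 0%N = 1 -> t 0%N = 1 ->
    (forall N, (0 < N <= K)%N -> \sum_(0 <= i < N.+1) s i * s (N - i)%N =
                           \sum_(0 <= i < N.+1) t i * t (N - i)%N) ->
  forall N, (N <= K)%N -> s N = t N.
Proof.
move=> two s0 t0 h; elim/ltn_ind => -[|N] IH leK; first by rewrite s0 t0.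
have := h N.+1 leK; rewrite !(big_ltn (ltn0Sn _)) !(big_nat_recr N.+1) //=.
rewrite subn0 subnn s0 t0 !mul1r !mulr1.
rewrite (@eq_big_nat _ _ _ _ _ (fun i => s i * s (N.+1 - i)%N)
  (fun i => t i * t (N.+1 - i)%N)); last first.
  by move=> i hi; rewrite !IH //; lia.
set x := \sum_(_ <= _ < _) _ => /eqP; rewrite -subr_eq0.
have -> : s N.+1 + (x + s N.+1) - (t N.+1 + (x + t N.+1)) = 2 * (s N.+1 - t N.+1) by ring.
by rewrite mulf_eq0 (negPf two) /= subr_eq0 => /eqP.
Qed.

Section Pmk.
Variables (f : fieldType) (m k : nat).
Hypotheses (two : (2 : f) != 0) (k_gt0 : (0 < k)%N).
Local Notation K := (m + k)%N.
Local Notation P := (Pmk f m k).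
Local Notation sa := (sqrt_series (radicand f K K)).
Local Notation sb := (sqrt_series (radicand f K m)).

Lemma two_mpoly n : (2 : {mpoly f[n]}) != 0.
Proof. by rewrite -[2]mpolyC_nat mpolyC_eq0. Qed.

Lemma sqrt_radicandP (M N : nat) :
  \sum_(0 <= i < N.+1) sqrt_series (radicand f K M) i * sqrt_series (radicand f K M) (N - i) =
  radicand f K M N.
Proof. exact: sqrt_seriesP. Qed.

Definition kill_last : K.+1.-tuple {mpoly f[K.+1]} :=
  [tuple if i == ord_max then 0 else 'X_i | i < K.+1].

Lemma kill_lastX (j : nat) : (j < K)%N -> 'X_(inord j) \mPo kill_last = 'X_(inord j).
Proof.
move=> lt_jK; rewrite comp_mpolyXU -tnth_nth tnth_mktuple -val_eqE /= inordK.
  by rewrite ltn_eqF.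
exact: leqW.
Qed.

Lemma kill_lastX0 : 'X_ord0 \mPo kill_last = 'X_ord0.
Proof.
have -> : ord0 = inord 0 :> 'I_K.+1 by apply: val_inj; rewrite /= inordK.
by rewrite kill_lastX // addn_gt0 k_gt0 orbT.
Qed.

Lemma kill_last_radicand M N : (N < K)%N || (M < N)%N ->
  radicand f K M N \mPo kill_last = radicand f K M N.
Proof.
rewrite /radicand => h; case: eqP => _; first by rewrite rmorph1.
case: (leqP N M) h => [_|_ _]; last by rewrite comp_mpoly0.
rewrite orbF => ltNK.
by rewrite rmorphM rmorphXn /= kill_lastX // kill_lastX0.
Qed.

Lemma kill_last_sqrt M B :
    (forall N, (N <= B)%N ->
       radicand f K M N \mPo kill_last = radicand f K M N) ->
  forall N, (N <= B)%N ->
    sqrt_series (radicand f K M) N \mPo kill_last = sqrt_series (radicand f K M) N.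
Proof.
move=> h; apply: (sqrt_unique (two_mpoly _)); rewrite ?sqrt_series0 ?rmorph1 //.
move=> N /andP[_ leNB]; rewrite sqrt_radicandP -h // -[in RHS]sqrt_radicandP.
by rewrite rmorph_sum; apply: eq_bigr => i _; rewrite rmorphM.
Qed.

(** x_(m+k) enters only through the last coefficient of the first radicand, so
    that P_mk has degree 1 in it, with the coefficient x_0^(k-1) / 2, a unit
    as soon as x_0 is one. *)
Lemma Pmk_split :
  P = 2^-1 *: ('X_ord0 ^+ k.-1 * 'X_ord_max) + (P \mPo kill_last).
Proof.
have K0 : (0 < K)%N by rewrite addn_gt0 k_gt0 orbT.
have X0 : 'X_ord0 ^+ m != 0 :> {mpoly f[K.+1]} by rewrite expf_neq0 // -msize_poly_eq0 msizeX.
apply: (mulfI X0); rewrite mulrDr PmkE.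
have -> : 'X_ord0 ^+ m * (P \mPo kill_last) = sqrt_diff f m k \mPo kill_last.
  by rewrite -PmkE rmorphM rmorphXn /= kill_lastX0.
rewrite /sqrt_diff rmorphB /=.
rewrite (@kill_last_sqrt m K) //; last first.
  by move=> N _; apply: kill_last_radicand; case: (leqP N m) => //; lia.
rewrite sqrt_seriesS // comp_mpolyZ rmorphB rmorph_sum /=.
have -> : radicand f K K K \mPo kill_last = 0.
  rewrite /radicand gtn_eqF // leqnn rmorphM /= comp_mpolyXU -tnth_nth.
  by rewrite tnth_mktuple -val_eqE /= inordK // eqxx mul0r.
have -> : \sum_(1 <= i < K) ((sa i * sa (K - i)%N) \mPo kill_last) =
    \sum_(1 <= i < K) sa i * sa (K - i)%N.
  apply: eq_big_nat => i hi; rewrite rmorphM /= !(@kill_last_sqrt K K.-1) //; try lia.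
    by move=> N leN; apply: kill_last_radicand; lia.
  by move=> N leN; apply: kill_last_radicand; lia.
have -> : radicand f K K K = 'X_ord_max * 'X_ord0 ^+ K.-1.
  rewrite /radicand gtn_eqF // leqnn; congr ('X_ _ * _).
  by apply: val_inj; rewrite /= inordK.
have -> : K.-1 = (m + k.-1)%N by lia.
rewrite exprD sub0r scalerBr scalerN -scalerAr.
rewrite ['X_ord_max * _]mulrC -[_ * _ * 'X_ord_max]mulrA.
by rewrite addrA.
Qed.

Implicit Types x : 'I_K.+1 -> f.

Lemma Pmk_last_inj x x' : x ord0 != 0 ->
  (forall i : 'I_K.+1, (i < K)%N -> x i = x' i) ->
  P.@[x] = P.@[x'] -> x ord_max = x' ord_max.
Proof.
move=> x0 h.
have K0 : (0 < K)%N by rewrite addn_gt0 k_gt0 orbT.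
rewrite Pmk_split !mevalD !mevalZ !mevalM !rmorphXn /= !mevalXU !comp_mpoly_meval.
set u := P.@[_]; set u' := P.@[_].
have -> : u = u'.
  apply: meval_eq => i; rewrite !tnth_mktuple; case: eqP => [_|/eqP ne].
    by rewrite !meval0.
  rewrite !mevalXU h //; move: ne; rewrite -val_eqE /= => ne.
  by rewrite ltn_neqAle ne -ltnS ltn_ord.
move/addIr/(mulfI (invr_neq0 two)); rewrite -(h ord0) //.
by apply: mulfI; rewrite expf_neq0.
Qed.

Lemma radicand_meval M N x : (radicand f K M N).@[x] =
  if N == 0%N then 1 else if (N <= M)%N then x (inord N) * x ord0 ^+ N.-1 else 0.
Proof.
rewrite /radicand; case: eqP => _; first by rewrite meval1.
by case: leqP => _; rewrite ?meval0 // mevalM rmorphXn /= !mevalXU.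
Qed.

Lemma sqrt_radicand_meval M x N :
  \sum_(0 <= i < N.+1) (sqrt_series (radicand f K M) i).@[x] *
     (sqrt_series (radicand f K M) (N - i)).@[x] = (radicand f K M N).@[x].
Proof.
by rewrite -sqrt_radicandP rmorph_sum; apply: eq_bigr => i _; rewrite rmorphM.
Qed.

(** The radicand is that of the series x_0^-1 (x_0 + x_1 t + x_2 t^2 + ...)
    after the rescaling t = x_0 z, whence the power of x_0. *)
Lemma sqrt_radicand_poly x (S : {poly f}) : x ord0 != 0 -> S`_0 = 1 ->
    (forall i : 'I_K.+1, x ord0 * (S ^+ 2)`_i = x i) ->
  forall N, (N <= K)%N -> (sa N).@[x] = x ord0 ^+ N * S`_N.
Proof.
move=> x0 S0 hS; apply: sqrt_unique => //; rewrite ?sqrt_series0 ?meval1 //.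
  by rewrite expr0 mul1r.
move=> N /andP[N0 leN]; rewrite sqrt_radicand_meval radicand_meval gtn_eqF // leN.
rewrite -hS inordK ?ltnS // expr2 coefM.
rewrite -(big_mkord xpredT (fun i => S`_i * S`_(N - i))) mulrAC -exprS prednK //.
rewrite mulr_sumr; apply: eq_big_nat => i /andP[_]; rewrite ltnS => leiN.
rewrite -{1}(subnKC leiN) exprD.
by move: (x ord0 ^+ i) (x ord0 ^+ _) => a b; ring.
Qed.

(** The meaning of P_mk: modulo a function of x_0, ..., x_m it is the
    coefficient of t^(m+k) in the square root S of the series of the x_i. *)
Lemma Pmk_eval_eq x x' (S S' : {poly f}) : x ord0 != 0 ->
    (forall i : 'I_K.+1, (i <= m)%N -> x i = x' i) ->
    S`_0 = 1 -> S'`_0 = 1 ->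
    (forall i : 'I_K.+1, x ord0 * (S ^+ 2)`_i = x i) ->
    (forall i : 'I_K.+1, x ord0 * (S' ^+ 2)`_i = x' i) ->
    S`_K = S'`_K ->
  P.@[x] = P.@[x'].
Proof.
move=> x0 h S0 S'0 hS hS' SK; have E0 : x ord0 = x' ord0 by apply: h.
have ev y : y ord0 ^+ m * P.@[y] = (sa K).@[y] - (sb K).@[y].
  by rewrite -mevalB -/(sqrt_diff f m k) -PmkE mevalM rmorphXn /= mevalXU.
apply: (mulfI (expf_neq0 m x0)); rewrite ev {1}E0 ev.
rewrite (sqrt_radicand_poly x0 S0 hS) //.
have x'0 : x' ord0 != 0 by rewrite -E0.
rewrite (sqrt_radicand_poly x'0 S'0) //; last by move=> i; rewrite -E0 hS'.
rewrite -E0 SK; congr (_ - _).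
suff H N : (N <= K)%N -> (sb N).@[x] = (sb N).@[x'] by exact: H.
move: N; apply: sqrt_unique => //; rewrite ?sqrt_series0 ?meval1 //.
move=> N /andP[_ leN]; rewrite !sqrt_radicand_meval !radicand_meval -E0.
by case: eqP => // _; case: leqP => // leNm; rewrite h // inordK.
Qed.

Lemma sqrt_poly_exists x : x ord0 != 0 -> exists S : {poly f}, S`_0 = 1 /\
   forall i : 'I_K.+1, x ord0 * (S ^+ 2)`_i = x i.
Proof.
move=> x0; exists (\poly_(i < K.+1) ((sa i).@[x] / x ord0 ^+ i)); split.
  by rewrite coef_poly sqrt_series0 meval1 expr0 divr1.
move=> i; apply: (mulfI (expf_neq0 i x0)).
have -> : x ord0 ^+ i * x i = x ord0 * (radicand f K K i).@[x].
  rewrite radicand_meval; case: eqP => [i0|/eqP i0].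
    by rewrite i0 expr0 mulr1 mul1r; congr (x _); apply: val_inj.
  rewrite -ltnS ltn_ord inord_val mulrCA -exprS prednK ?lt0n //.
  by rewrite mulrC.
rewrite -sqrt_radicand_meval mulrCA; congr (_ * _).
rewrite expr2 coefM; set T := \poly_(_ < _) _.
rewrite -(big_mkord xpredT (fun j => T`_j * T`_(i - j))) mulr_sumr; apply: eq_big_nat => j /andP[_].
rewrite ltnS => leji.
have lti : (i < K.+1)%N by [].
rewrite /T !coef_poly (leq_ltn_trans leji lti) (leq_ltn_trans (leq_subr _ _) lti).
rewrite -{1}(subnKC leji) exprD; set a := _ ^+ j; set b := _ ^+ (i - j).
have a0 : a != 0 by apply: expf_neq0.
have b0 : b != 0 by apply: expf_neq0.
by rewrite mulrACA ![_ * (_ / _)]mulrC !divfK.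
Qed.

End Pmk.

Lemma Pmk_last_surj (f : fieldType) (m k : nat) (x : 'I_(m + k).+1 -> f) (y : f) :
    (2 : f) != 0 -> (0 < k)%N -> x ord0 != 0 ->
  exists x', (forall i : 'I_(m + k).+1, (i < m + k)%N -> x' i = x i) /\ (Pmk f m k).@[x'] = y.
Proof.
move=> two k0 x0.
pose x'' z := fun i : 'I_(m + k).+1 => if i == ord_max then z else x i.
pose u := (Pmk f m k).@[x'' 0].
exists (x'' ((y - u) * (2 / x ord0 ^+ k.-1))); split=> [i lt_i|].
  by rewrite /x'' -val_eqE /= ltn_eqF.
have nz : ord0 != ord_max :> 'I_(m + k).+1.
  by rewrite -val_eqE /= eq_sym -lt0n addn_gt0 k0 orbT.
rewrite (Pmk_split m two k0) mevalD mevalZ mevalM rmorphXn /= !mevalXU comp_mpoly_meval.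
have -> : (Pmk f m k).@[fun i => (tnth (kill_last f m k) i).@[x'' ((y - u) * (2 / x ord0 ^+ k.-1))]] = u.
  apply: meval_eq => i; rewrite tnth_mktuple /x''; case: eqP => [_|/eqP ne].
    by rewrite meval0.
  by rewrite mevalXU (negPf ne).
rewrite /x'' eqxx (negPf nz).
move: (expf_neq0 k.-1 x0) u; move: (x ord0 ^+ _) => a a0 u.
by field; rewrite a0 two.
Qed.

(** * Graphs are affine varieties *)

Lemma comp_mpolyA (f : fieldType) (n1 n2 n3 : nat) (P : {mpoly f[n1]})
    (a : n1.-tuple {mpoly f[n2]}) (b : n2.-tuple {mpoly f[n3]}) :
  (P \mPo a) \mPo b = P \mPo [tuple (tnth a i) \mPo b | i < n1].
Proof.
rewrite [P \mPo a]comp_mpolyEX [RHS]comp_mpolyEX raddf_sum /=.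
apply: eq_bigr => mm _; rewrite comp_mpolyZ; congr (_ *: _).
rewrite !comp_mpolyX rmorph_prod /=; apply: eq_bigr => i _.
by rewrite rmorphXn /= tnth_mktuple.
Qed.

Section AlgDep.
Variables (f : fieldType).

(** Unlike [msize], this is subadditive under products without exception for
    zero polynomials. *)
Definition mdegree n (q : {mpoly f[n]}) := (msize q).-1.

Lemma mdegreeM n (q r : {mpoly f[n]}) : (mdegree (q * r) <= mdegree q + mdegree r)%N.
Proof.
rewrite /mdegree; have [->|q0] := eqVneq q 0; first by rewrite mul0r msize0.
have [->|r0] := eqVneq r 0; first by rewrite mulr0 msize0.
by rewrite msizeM //; move: (msize q) (msize r) => a b; lia.
Qed.

Lemma mdegreeX n (q : {mpoly f[n]}) k : (mdegree (q ^+ k) <= k * mdegree q)%N.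
Proof.
elim: k => [|k IH]; first by rewrite expr0 /mdegree -mpolyC1 msizeC oner_eq0.
by rewrite exprS; apply: leq_trans (mdegreeM _ _) _; rewrite mulSn leq_add2l.
Qed.

Lemma mdegree_prod n (I : Type) (r : seq I) (F : I -> {mpoly f[n]}) :
  (mdegree (\prod_(i <- r) F i) <= \sum_(i <- r) mdegree (F i))%N.
Proof.
elim: r => [|i r IH].
  by rewrite !big_nil /mdegree -mpolyC1 msizeC oner_eq0.
by rewrite !big_cons; apply: leq_trans (mdegreeM _ _) _; rewrite leq_add2l.
Qed.

Lemma mdegree_coef n (q : {mpoly f[n]}) mm : (mdegree q < mdeg mm)%N -> q@_mm = 0.
Proof.
move=> h; apply: memN_msupp_eq0; apply: msize_mdeg_ge.
by move: h; rewrite /mdegree; case: (msize q).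
Qed.

(** A dimension count: the monomials in the q_i with exponents below M are more
    numerous than the monomials, of degree below B = C M, in which they are
    expressed, as M^(d+1) > C^d M^d. *)
Lemma alg_dependent d (q : d.+1.-tuple {mpoly f[d]}) :
  exists2 R : {mpoly f[d.+1]}, R != 0 & R \mPo q = 0.
Proof.
pose D := (\max_i mdegree (tnth q i))%N.
pose C := (d.+1 * D).+1.
pose M := (C ^ d).+1.
pose B := (C * M)%N.
pose T := {ffun 'I_d.+1 -> 'I_M}; pose U := {ffun 'I_d -> 'I_B}.
have ltUT : (#|U| < #|T|)%N.
  rewrite !card_ffun !card_ord /B expnMn expnSr mulnC ltn_pmul2l //.
  by rewrite expn_gt0.
pose mono (e : T) : 'X_{1..d.+1} := [multinom (e i : nat) | i < d.+1].
pose monoU (e : U) : 'X_{1..d} := [multinom (e i : nat) | i < d].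
have mono_inj : injective mono.
  move=> e1 e2 /mnmP E; apply/ffunP => i; apply: val_inj.
  by have := E i; rewrite !mnmE.
pose A := \matrix_(i < #|T|, j < #|U|) ('X_[mono (enum_val i)] \mPo q)@_(monoU (enum_val j)).
have kA : kermx A != 0.
  rewrite -mxrank_eq0 mxrank_ker subn_eq0 -ltnNge.
  exact: leq_ltn_trans (rank_leq_col A) ltUT.
have /rowV0Pn[r /sub_kermxP rA r0] := kA.
exists (\sum_i r 0 i *: 'X_[mono (enum_val i)]).
  apply: contra r0 => /eqP E; apply/eqP/rowP => i; rewrite [RHS]mxE.
  have := congr1 (mcoeff (mono (enum_val i))) E; rewrite mcoeff0 => <-.
  rewrite raddf_sum (bigD1 i) //= mcoeffZ mcoeffX eqxx mulr1 big1 ?addr0 //.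
  move=> j ne; rewrite mcoeffZ mcoeffX (inj_eq mono_inj) (inj_eq enum_val_inj).
  by rewrite (negPf ne) mulr0.
apply/mpolyP => mm; rewrite mcoeff0 (raddf_sum (comp_mpoly q)) raddf_sum /=.
under eq_bigr do rewrite comp_mpolyZ mcoeffZ.
case: (ltnP (mdeg mm) B) => [lt_mB|le_Bm]; last first.
  rewrite big1 // => i _; rewrite mdegree_coef ?mulr0 //.
  apply: leq_trans le_Bm; rewrite comp_mpolyX.
  apply: (@leq_ltn_trans (\sum_(j < d.+1) M.-1 * D)%N).
    apply: leq_trans (mdegree_prod _ _) _; apply: leq_sum => j _.
    apply: leq_trans (mdegreeX _ _) _; apply: leq_mul.
      by rewrite mnmE -ltnS; apply: ltn_ord.
    by rewrite /D; apply: (leq_bigmax j).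
  have aux (a b c : nat) : (a * (c * b) < (a * b).+1 * c.+1)%N.
    by rewrite mulSn mulnS mulnCA mulnA mulnC; lia.
  by rewrite sum_nat_const card_ord; apply: aux.
have mB i : (mm i < B)%N.
  by apply: leq_ltn_trans lt_mB; rewrite mdegE (bigD1 i) //= leq_addr.
pose e : U := [ffun i => Ordinal (mB i)].
have mE : mm = monoU e by apply/mnmP => i; rewrite mnmE ffunE.
have := congr1 (fun Z : 'rV_#|U| => Z 0 (enum_rank e)) rA.
rewrite !mxE => {2}<-; apply: eq_bigr => i _.
by rewrite !mxE enum_rankK -mE.
Qed.
End AlgDep.

Section Graph.
Variables (f : fieldType) (N d : nat) (E : seq {mpoly f[N]}).
Variables (s : N.-tuple {mpoly f[d]}) (t : d.-tuple {mpoly f[N]}).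
Local Notation I := (ideal_gen E).

Lemma ideal_gen0 : I 0.
Proof. by exists (fun=> 0); rewrite big1 // => i _; rewrite mul0r. Qed.

Lemma ideal_genD a b : I a -> I b -> I (a + b).
Proof.
move=> [u ->] [v ->]; exists (fun i => u i + v i).
by rewrite -big_split; apply: eq_bigr => i _; rewrite mulrDl.
Qed.

Lemma ideal_genM a b : I b -> I (a * b).
Proof.
move=> [u ->]; exists (fun i => a * u i).
by rewrite mulr_sumr; apply: eq_bigr => i _; rewrite mulrA.
Qed.

Lemma ideal_gen_mem a : a \in E -> I a.
Proof.
move=> aE; have lt : (index a E < size E)%N by rewrite index_mem.
exists (fun i => if i == Ordinal lt then 1 else 0).
rewrite (bigD1 (Ordinal lt)) //= eqxx mul1r nth_index // big1 ?addr0 //.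
by move=> i /negPf ->; rewrite mul0r.
Qed.

Lemma ideal_gen_comp n (P : {mpoly f[n]}) (a b : n.-tuple {mpoly f[N]}) :
  (forall i, I (tnth a i - tnth b i)) -> I ((P \mPo a) - (P \mPo b)).
Proof.
move=> h; rewrite !comp_mpolyEX -sumrB.
elim/big_ind: _ => [|x y|mm _]; [exact: ideal_gen0 | exact: ideal_genD|].
rewrite -scalerBr -mul_mpolyC; apply: ideal_genM; rewrite !comp_mpolyX.
elim/big_rec2: _ => [|i x y _ Ixy]; first by rewrite subrr; exact: ideal_gen0.
have IX k : I (tnth a i ^+ k - tnth b i ^+ k).
  by rewrite subrXX mulrC; apply/ideal_genM/h.
have -> : tnth a i ^+ mm i * y - tnth b i ^+ mm i * x =
   tnth a i ^+ mm i * (y - x) + x * (tnth a i ^+ mm i - tnth b i ^+ mm i).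
  by move: (_ ^+ _) (_ ^+ _) => u v; ring.
by apply: ideal_genD; apply: ideal_genM.
Qed.

Hypothesis sE : forall q, q \in E -> q \mPo s = 0.
Hypothesis st : forall i, tnth t i \mPo s = 'X_i.
Hypothesis ts : forall j, I ('X_j - (tnth s j \mPo t)).

(** Modulo the ideal every P is congruent to its image under s followed
    by t. *)
Lemma graph_ideal P : I P <-> P \mPo s = 0.
Proof.
split=> [[a ->]|P0].
  rewrite (raddf_sum (comp_mpoly s)) big1 //= => i _.
  by rewrite rmorphM /= [X in _ * X]sE ?mulr0 // mem_nth.
rewrite -[P]subr0 -[X in _ - X](comp_mpoly0 t) -P0 comp_mpolyA.
rewrite -{1}[P]comp_mpoly_id; apply: ideal_gen_comp => i.
by rewrite !tnth_mktuple.
Qed.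

(** If s and t are inverse to each other modulo the equations E, the ideal of E
    is the kernel of the substitution s, and the coordinate ring is a polynomial
    ring in d variables; its transcendence degree is d by [alg_dependent]. *)
Lemma graph_affine_variety : affine_variety d E.
Proof.
split.
- split; first by rewrite graph_ideal rmorph1; apply/eqP/oner_neq0.
  move=> a b; rewrite !graph_ideal rmorphM => /eqP; rewrite mulf_eq0.
  by case/orP => /eqP; [left | right].
- exists t => R; rewrite graph_ideal comp_mpolyA.
  rewrite (_ : [tuple _ | _ < _] = [tuple 'X_i | i < d]) ?comp_mpoly_id //.
  by apply: eq_from_tnth => i; rewrite !tnth_mktuple st.
move=> q alg.
have [R /eqP R0 Rq] := alg_dependent [tuple (tnth q i) \mPo s | i < d.+1].
by apply: R0; apply: alg; rewrite graph_ideal comp_mpolyA.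
Qed.

End Graph.

(** * The equations of the orbits when n is even *)

Section Variety.
Variables (f : fieldType) (m k : nat).
Hypotheses (two : (2 : f) != 0) (k_gt0 : (0 < k)%N).
Local Notation K := (m + k)%N.
Local Notation P := (Pmk f m k).

(** The form of [Pmk_split] that serves in the coordinate ring. *)
Lemma Pmk_comp_split r (z z' : K.+1.-tuple {mpoly f[r]}) :
    (forall i : 'I_K.+1, (i < K)%N -> tnth z i = tnth z' i) -> tnth z' ord_max = 0 ->
  P \mPo z = 2^-1 *: (tnth z ord0 ^+ k.-1 * tnth z ord_max) + (P \mPo z').
Proof.
move=> hz z'0; rewrite {1}(Pmk_split m two k_gt0) comp_mpolyD comp_mpolyZ.
rewrite rmorphM rmorphXn /= !comp_mpolyXU -!tnth_nth comp_mpolyA; congr (_ + (_ \mPo _)).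
apply: eq_from_tnth => i; rewrite !tnth_mktuple; case: eqP => [->|/eqP ne].
  by rewrite comp_mpoly0 z'0.
rewrite comp_mpolyXU -tnth_nth hz // ltn_neqAle -ltnS ltn_ord andbT.
by move: ne; rewrite -val_eqE.
Qed.

(** [orbit_equations] with independent parameters N and k.  If c_0 <> 0 the last
    equation can be solved for X_K, so that the equations define the graph of
    a polynomial function of the other variables X_j with j > m. *)
Definition level_equations N (c : 'I_m.+2 -> f) : seq {mpoly f[N.+1]} :=
  rcons [seq 'X_(inord j) - (c (widen_ord (leqnSn _) j))%:MP | j : 'I_m.+1 <- enum 'I_m.+1]
    ((P \mPo [tuple 'X_(inord j) | j < K.+1]) - (c ord_max)%:MP).

Lemma level_equation_mem N c (j : 'I_m.+1) :
  ('X_(inord j) - (c (widen_ord (leqnSn _) j))%:MP) \in level_equations N c.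
Proof.
rewrite mem_rcons inE; apply/orP; right.
by apply/mapP; exists j; rewrite ?mem_enum.
Qed.

Variables (d : nat) (c : 'I_m.+2 -> f).
Hypotheses (c0 : c ord0 != 0) (leKN : (K <= m.+2 + d)%N).
Local Notation N := (m.+2 + d)%N.
Local Notation E := (level_equations N c).
Local Notation I := (ideal_gen E).

(** The variables X_j with j > m and j <> K are numbered from 0 on, by skipping
    the place k - 1 of X_K among those with j > m. *)
Definition level_base (j : nat) : {mpoly f[d.+1]} :=
  if (j <= m)%N then (c (inord j))%:MP else 'X_(inord (unbump k.-1 (j - m.+1))).

Definition level_trunc : K.+1.-tuple {mpoly f[d.+1]} :=
  [tuple if i == ord_max then 0 else level_base i | i < K.+1].

Definition level_solution : {mpoly f[d.+1]} :=
  (2 / c ord0 ^+ k.-1) *: ((c ord_max)%:MP - (P \mPo level_trunc)).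

Definition level_param : N.+1.-tuple {mpoly f[d.+1]} :=
  [tuple if (j : nat) == K then level_solution else level_base j | j < N.+1].

Definition level_free : d.+1.-tuple {mpoly f[N.+1]} :=
  [tuple 'X_(inord (m.+1 + bump k.-1 i)) | i < d.+1].

Lemma level_paramX (j : nat) : (j <= N)%N ->
  'X_(inord j) \mPo level_param = if j == K then level_solution else level_base j.
Proof. by move=> leN; rewrite comp_mpolyXU -tnth_nth tnth_mktuple inordK. Qed.

Lemma level_vanish q : q \in E -> q \mPo level_param = 0.
Proof.
rewrite mem_rcons inE => /orP[/eqP->|/mapP[j _ ->]]; last first.
  rewrite comp_mpolyB comp_mpolyC level_paramX; last by have := ltn_ord j; lia.
  rewrite ltn_eqF; last by have := ltn_ord j; lia.
  rewrite /level_base -ltnS ltn_ord (_ : inord j = widen_ord (leqnSn _) j) ?subrr //.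
  by apply: val_inj; rewrite /= inordK // leqW.
rewrite comp_mpolyB comp_mpolyC comp_mpolyA (Pmk_comp_split (z' := level_trunc)); last first.
- by rewrite tnth_mktuple eqxx.
- move=> i lt_iK; rewrite !tnth_mktuple level_paramX; last by lia.
  by rewrite ltn_eqF // -val_eqE /= ltn_eqF.
rewrite !tnth_mktuple !level_paramX //= eqxx ltn_eqF; last by lia.
rewrite /level_base /= (_ : inord 0 = ord0); last by apply: val_inj; rewrite /= inordK.
rewrite /level_solution -scalerAr scalerA -rmorphXn mul_mpolyC /= scalerA.
rewrite mulrA mulVf // mul1r mulVf ?expf_neq0 // scale1r.
by rewrite subrK subrr.
Qed.

Lemma level_free_param i : tnth level_free i \mPo level_param = 'X_i.
Proof.
have lt_i := ltn_ord i.
rewrite tnth_mktuple level_paramX; last by rewrite /bump; lia.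
rewrite (_ : _ == _ = false); last by rewrite /bump; lia.
rewrite /level_base ifN; last by rewrite -ltnNge; lia.
by rewrite addKn bumpK inord_val.
Qed.

Lemma level_base_mod (j : nat) : (j <= N)%N -> j != K ->
  I ('X_(inord j) - (level_base j \mPo level_free)).
Proof.
move=> leN /eqP jK; rewrite /level_base; case: leqP => [lejm|ltmj].
  rewrite comp_mpolyC; apply: ideal_gen_mem.
  rewrite (_ : inord j = widen_ord (leqnSn _) (Ordinal (lejm : (j < m.+1)%N))).
    exact: (level_equation_mem _ _ (Ordinal (lejm : (j < m.+1)%N))).
  by apply: val_inj; rewrite /= inordK // ltnS leqW.
rewrite comp_mpolyXU -tnth_nth tnth_mktuple inordK; last by rewrite /unbump; lia.
rewrite unbumpK; last by rewrite inE; lia.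
by rewrite subnKC // subrr; apply: ideal_gen0.
Qed.

(** The case j = K uses the linearity of P_mk in X_K, see [Pmk_split]. *)
Lemma level_param_mod j : I ('X_j - (tnth level_param j \mPo level_free)).
Proof.
rewrite tnth_mktuple -{1}[j]inord_val; case: eqP => [jK|/eqP jK]; last first.
  by apply: level_base_mod => //; rewrite -ltnS.
pose w := [tuple 'X_(inord j) | j < K.+1] : K.+1.-tuple {mpoly f[N.+1]}.
pose u : K.+1.-tuple {mpoly f[N.+1]} := [tuple if i == ord_max then 0 else 'X_(inord i) | i < K.+1].
have Ew : I ((P \mPo w) - (c ord_max)%:MP).
  by apply: ideal_gen_mem; rewrite mem_rcons inE eqxx.
have Eu : I ((P \mPo u) - ((P \mPo level_trunc) \mPo level_free)).
  rewrite comp_mpolyA; apply: ideal_gen_comp => i; rewrite !tnth_mktuple.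
  case: eqP => [_|/eqP ne]; first by rewrite comp_mpoly0 subrr; apply: ideal_gen0.
  have lt_i := ltn_ord i.
  by apply: level_base_mod; [lia | move: ne; rewrite -val_eqE].
have E0 : I ('X_(inord 0) ^+ k.-1 - (c ord0 ^+ k.-1)%:MP).
  rewrite rmorphXn /= subrXX mulrC; apply: ideal_genM.
  have := level_equation_mem N c ord0; rewrite (_ : widen_ord _ _ = ord0) /=.
    exact: ideal_gen_mem.
  exact: val_inj.
have Pw : P \mPo w = (2^-1)%:MP * ('X_(inord 0) ^+ k.-1 * 'X_(inord K)) + (P \mPo u).
  rewrite (Pmk_comp_split (z' := u)) ?mul_mpolyC; last by rewrite tnth_mktuple eqxx.
    by rewrite !tnth_mktuple.
  by move=> i lt_i; rewrite !tnth_mktuple -val_eqE /= ltn_eqF.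
rewrite jK /level_solution comp_mpolyZ comp_mpolyB comp_mpolyC -mul_mpolyC.
set a := (2 / _)%:MP.
have ac : a * (2^-1)%:MP * (c ord0 ^+ k.-1)%:MP = 1.
  rewrite -!mpolyCM -mpolyC1; congr (_ %:MP).
  by rewrite mulrAC divfK ?mulfV // expf_neq0.
move: Ew Eu E0 Pw ac; set q := (_ \mPo level_free).
move: (2^-1)%:MP (c ord0 ^+ _)%:MP (_ ^+ k.-1) (P \mPo w) (P \mPo u)
  (c ord_max)%:MP 'X_(inord K) a q.
move=> h ck Xk pw pu cm XK a q Ew Eu E0 Pw ac.
have -> : XK - a * (cm - q) =
    (- (a * h * XK)) * (Xk - ck) + (a * (pw - cm) + (- a) * (pu - q)).
  rewrite Pw; transitivity ((a * h * ck) * XK - a * (cm - q)); first by rewrite ac mul1r.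
  by ring.
by apply: ideal_genD; [|apply: ideal_genD]; apply: ideal_genM.
Qed.

Lemma level_affine_variety : affine_variety d.+1 E.
Proof.
apply: (graph_affine_variety (s := level_param) (t := level_free)).
- exact: level_vanish.
- exact: level_free_param.
exact: level_param_mod.
Qed.

End Variety.

(** * The orbits in general position *)

Section Final.
Variables (f : fieldType) (p : nat).
Hypothesis pch : p \in [pchar f].
Let p_gt1 : (1 < p)%N. Proof. by have /andP[/prime_gt1] := pch. Qed.

Lemma two_neq0 : (2 < p)%N -> (2 : f) != 0.
Proof.
move=> p2; rewrite -(dvdn_pcharf pch); apply/negP => /(dvdn_leq (ltn0Sn _)).
by rewrite leqNgt p2.
Qed.

Section Fixed.
Variables (m n : nat).
Hypotheses (ltmn : (m < n)%N) (lt_np : (n < p.-1)%N).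
Implicit Types lam mu : Ldual f p m.+1.
Local Notation G := (Gsub f p m.+1).

(** Let ell_n (S t^(-K-1) dt)^2, with K = m + k, be the quadratic differential
    attached to lam.  The residue of S t^(-K-1) dt is the coefficient of t^K
    in S; as ell_n is fixed, it is
    preserved by automorphisms, and so is P_mk, which is this residue up to a
    function of the fixed coordinates. *)
Lemma coad_Pmk k g lam : n = (2 * (m + k))%N -> (1 < k)%N -> G g ->
    Lquodual f p m.+1 n.+1 lam -> ell n lam != 0 ->
  (Pmk f m k).@[fun i => ell (n - i) (coad g lam)] =
  (Pmk f m k).@[fun i => ell (n - i) lam].
Proof.
move=> nE k1 Gg hlam l0.
have two : (2 : f) != 0 by apply: two_neq0; lia.
have k0 : (0 < k)%N by exact: ltnW.
have [v [w [gv vw [a hv]]]] := Gsub_unit pch (ltn0Sn m) Gg.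
pose x (i : 'I_(m + k).+1) := ell (n - i) lam.
have x0 : x ord0 != 0 by rewrite /x subn0.
have [S [S0 hS]] := sqrt_poly_exists two x0.
have v0 : v.[0] = 1.
  by rewrite horner_coef0 (eqX_coef hv) // coefD coef1 coefZ coefXn mulr0 addr0.
have w0 : w.[0] = 1.
  have := eqX_coef vw (ltnW p_gt1).
  by rewrite -!horner_coef0 hornerM v0 mul1r hornerC.
have hK : (m + k <= n - m.+1)%N by lia.
have vwK : eqX (m + k).+1 (v * w) 1 by apply: eqX_le vw; lia.
pose S' := ('X * v)^`() * (S \Po ('X * v)) * w ^+ (m + k).+1.
have E : eqX (m + k).+1 (x ord0 *: S' ^+ 2) (qdiff_pullback n v w (qdiff n lam)).
  rewrite {1}nE; apply: qdiff_pullback_sqrt; apply: coef_eqX => i lt_i.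
  rewrite coefZ (hS (Ordinal lt_i)) coef_qdiff //; exact: leq_trans hK.
symmetry; apply: (@Pmk_eval_eq f m k two x _ S S') => //.
- move=> i lei; rewrite /x coad_top_coords //; first lia.
- rewrite /S' -horner_coef0 !hornerM horner_exp w0 expr1n mulr1 horner_comp.
  rewrite hornerM hornerX mul0r [S.[0]]horner_coef0 S0 mulr1.
  by rewrite derivM derivX mul1r hornerD hornerM hornerX mul0r addr0.
- move=> i; have := eqX_coef E (ltn_ord i); rewrite coefZ => ->.
  have := ltn_ord i; rewrite ltnS => lei; rewrite (ell_coad_sub pch _ _ _ Gg gv vw) //.
  exact: leq_trans hK.
rewrite /S' [_^`() * _]mulrC (residue_change_of_variable _ pch) //; lia.
Qed.

Definition Gorbit lam := [set coad g lam | g in G].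

Lemma Gorbit_id lam : Gorbit lam lam.
Proof. by exists \1%VF; [apply: Gsub_id | rewrite coad_id]. Qed.

(** n = 2 K is impossible, so that every coordinate below ell_(n-m) can be
    moved freely. *)
Lemma Gorbit_odd lam : (2 * m + 2 < n)%N -> odd n -> Lquodual f p m.+1 n.+1 lam ->
  ell n lam != 0 -> Gorbit lam = orbit_plane f p m n (fun j => ell (n - j) lam).
Proof.
move=> ltn odd_n hlam l0; apply/seteqP; split=> mu.
  move=> [g Gg <-]; split; first exact: Lquodual_coad.
  by move=> j; have lt_j := ltn_ord j; apply: coad_top_coords => //; lia.
move=> [hmu hE]; have [|g K _ nE|g Gg <-] := coad_transitive pch (ltn0Sn m) ltmn lt_np hlam hmu l0.
- by move=> i lt_i _; rewrite (hE (Ordinal lt_i)).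
- by move: odd_n; rewrite nE oddM.
by exists g.
Qed.

(** The coordinate ell_(n/2) that cannot be moved is determined by the value of
    P_mk and the higher coordinates. *)
Lemma Gorbit_even k lam : n = (2 * (m + k))%N -> (1 < k)%N -> Lquodual f p m.+1 n.+1 lam ->
  ell n lam != 0 -> Gorbit lam =
  [set mu | [/\ Lquodual f p m.+1 n.+1 mu,
     forall j, (j <= m)%N -> ell (n - j) mu = ell (n - j) lam &
     (Pmk f m k).@[fun i => ell (n - i) mu] = (Pmk f m k).@[fun i => ell (n - i) lam]]].
Proof.
move=> nE k1 hlam l0; apply/seteqP; split=> mu.
  move=> [g Gg <-]; split; first exact: Lquodual_coad.
    by move=> j lej; apply: coad_top_coords => //; lia.
  exact: coad_Pmk.
move=> [hmu hE hP]; have [|g K Gg nE' leK hK|g Gg <-] :=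
  coad_transitive pch (ltn0Sn m) ltmn lt_np hlam hmu l0.
- by move=> i lt_i _; rewrite hE.
- have two : (2 : f) != 0 by apply: two_neq0; lia.
  have EK : K = (m + k)%N by lia.
  pose x (i : 'I_(m + k).+1) := ell (n - i) (coad g lam).
  pose x' (i : 'I_(m + k).+1) := ell (n - i) mu.
  have -> : K = (n - (ord_max : 'I_(m + k).+1))%N by rewrite /=; lia.
  apply: (@Pmk_last_inj f m k two (ltnW k1) x x').
  + by rewrite /x coad_top_coords // subn0.
  + by move=> i lt_i; apply: hK; rewrite EK.
  by rewrite /x /x' coad_Pmk // hP.
by exists g.
Qed.

Lemma orbitsP O : orbits f p m.+1 n.+1 O <->
  exists2 lam, Lquodual f p m.+1 n.+1 lam & O = Gorbit lam.
Proof.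
split=> [[lam hlam <-]|[lam hlam ->]]; exists lam => //; rewrite coad_orbitE //; exact: leqW.
Qed.

Lemma gp_orbitsP O : (2 * m + 2 < n)%N -> gp_orbits f p m n O <->
  exists lam, [/\ Lquodual f p m.+1 n.+1 lam, ell n lam != 0 & O = Gorbit lam].
Proof.
move=> lt2; split.
  move=> [/orbitsP[lam hlam OE] [|[_ h]]]; first by rewrite leqNgt lt2.
  by exists lam; split=> //; apply: h; rewrite OE; apply: Gorbit_id.
move=> [lam [hlam l0 ->]]; split; first by apply/orbitsP; exists lam.
right; split=> // mu [g Gg <-];
have := @coad_top_coords _ _ pch m.+1 n isT ltmn lt_np g lam 0%N Gg hlam.
by rewrite subn0 => ->.
Qed.

Definition top_dual (x : nat -> f) : Ldual f p m.+1 :=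
  @dual_of_coords f p m.+1 (fun i => if (i <= n)%N then x (n - i)%N else 0).

Lemma top_dual_quo x : Lquodual f p m.+1 n.+1 (top_dual x).
Proof.
apply/(LquodualP pch); first exact: leqW.
move=> i /andP[lt_ni lt_ip]; rewrite ell_dual_of_coords //; first by rewrite leqNgt lt_ni.
by rewrite lt_ip andbT ltnW // (leq_ltn_trans _ lt_ni).
Qed.

Lemma ell_top_dual x i : (i <= n - m.+1)%N -> ell (n - i) (top_dual x) = x i.
Proof.
move=> lei; rewrite ell_dual_of_coords //; last by apply/andP; split; lia.
by rewrite leq_subr subKn // (leq_trans lei) ?leq_subr.
Qed.


Lemma ellB i lam mu : ell i (lam - mu) = ell i lam - ell i mu.
Proof. by rewrite /ell add_lfunE opp_lfunE. Qed.

Section Plane.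
Variable d : nat.

(** These functionals, with arbitrary coordinates ell_(m+1), ..., ell_(m+d) and
    the others equal to 0, form the direction of the affine planes. *)
Definition low_dual (r : 'rV[f]_d) : Ldual f p m.+1 :=
  @dual_of_coords f p m.+1 (fun i => oapp (r 0) 0 (insub (i - m.+1)%N)).

Lemma low_dual_is_linear : linear low_dual.
Proof.
move=> a r s; apply/lfunP => x; rewrite add_lfunE scale_lfunE !dual_of_coordsE.
rewrite scaler_sumr -big_split /=; apply: eq_bigr => i _.
have scaleE (y z : f) : y *: (z : f^o) = y * z by [].
rewrite scaleE.
by case: insubP => [j _ _|_] /=; rewrite ?mxE; [move: (_`_ _) => y; ring | rewrite !mulr0 addr0].
Qed.
HB.instance Definition _ := GRing.isLinear.Build _ _ _ _ low_dual low_dual_is_linear.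

Lemma ell_low_dual r (j : 'I_d) : (m.+1 + d <= p.-1)%N -> ell (m.+1 + j) (low_dual r) = r 0 j.
Proof.
move=> led; have lt_j := ltn_ord j.
by rewrite ell_dual_of_coords ?addKn ?valK //; apply/andP; split; lia.
Qed.

Lemma low_dual_limgP mu : (m.+1 + d <= p.-1)%N ->
  mu \in limg (linfun low_dual) <->
  (forall i, (m.+1 + d <= i < p.-1)%N -> ell i mu = 0).
Proof.
move=> led; split=> [/memv_imgP[r _ ->] i /andP[le_i lt_i]|h].
  rewrite lfunE ell_dual_of_coords //; last by apply/andP; split; lia.
  by rewrite insubN //= -leqNgt; lia.
pose r := \row_(j < d) ell (m.+1 + j) mu.
apply/memv_imgP; exists r; first exact: memvf.
rewrite lfunE /=; apply: (Ldual_ext pch) => i /andP[le_i lt_i].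
case: (ltnP i (m.+1 + d)) => [lt_id|le_di].
  have lt_j : (i - m.+1 < d)%N by lia.
  by rewrite -(subnKC le_i) (ell_low_dual r (Ordinal lt_j)) // mxE.
rewrite h ?le_di // (ell_dual_of_coords pch); last by apply/andP.
by rewrite insubN //= -leqNgt; lia.
Qed.

Lemma dim_low_dual : (m.+1 + d <= p.-1)%N -> \dim (limg (linfun low_dual)) = d.
Proof.
move=> led; rewrite limg_dim_eq.
  by rewrite dimvf /dim /= mul1n.
rewrite capfv; apply/eqP/lker0P => r s; rewrite !lfunE /= => E.
by apply/rowP => j; rewrite -!(ell_low_dual _ j led) E.
Qed.
End Plane.

Lemma orbit_plane_affine (c : 'I_m.+1 -> f) : (2 * m + 2 < n)%N ->
  affine_plane (n - 2 * m - 1) (orbit_plane f p m n c).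
Proof.
move=> lt2; set d := (n - 2 * m - 1)%N.
have led : (m.+1 + d <= p.-1)%N by rewrite /d; lia.
pose a := top_dual (fun j => c (inord j)).
exists a, (limg (linfun (@low_dual d))); split; first exact: dim_low_dual.
have ha := top_dual_quo (fun j => c (inord j)).
have ea (j : 'I_m.+1) : ell (n - j) a = c j.
  by rewrite ell_top_dual ?inord_val //; have := ltn_ord j; lia.
have le1 : (m.+1 <= n.+1)%N by exact: leqW.
apply/seteqP; split=> mu /=.
  move=> [hmu hE]; apply/low_dual_limgP => // i /andP[le_i lt_i].
  rewrite ellB; case: (leqP i n) => [le_in|lt_ni].
    have lt_j : (n - i < m.+1)%N by move: le_i; rewrite /d; lia.
    by rewrite -(subKn le_in) (hE (Ordinal lt_j)) (ea (Ordinal lt_j)) subrr.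
  have hi : (n < i < p.-1)%N by rewrite lt_ni.
  move/(LquodualP pch): hmu => -> //; move/(LquodualP pch): ha => -> //.
  by rewrite subrr.
move/(low_dual_limgP _ led) => h; split.
  apply/(LquodualP pch) => // i /andP[lt_ni lt_ip].
  have := h i; rewrite ellB; move/(LquodualP pch): ha => -> //; last by rewrite lt_ni.
  by rewrite subr0; apply; rewrite lt_ip andbT /d; lia.
move=> j; have lt_j := ltn_ord j; apply/eqP; rewrite -ea -subr_eq0 -ellB h //.
by rewrite /d; apply/andP; split; lia.
Qed.

Lemma zero_locusP k (c : 'I_m.+2 -> f) : k = (n./2 - m)%N -> (m + k <= n - m.+1)%N ->
  zero_locus f p m n (orbit_equations f m n c) =
  [set mu | [/\ Lquodual f p m.+1 n.+1 mu,
     forall j : 'I_m.+1, ell (n - j) mu = c (widen_ord (leqnSn _) j) &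
     (Pmk f m k).@[fun i => ell (n - i) mu] = c ord_max]].
Proof.
move=> -> leK; apply/seteqP; split=> mu.
  move=> [hmu h]; split=> //.
    move=> j; have lt_j := ltn_ord j.
    have := h _ (level_equation_mem (n./2 - m) (n - m.+1) c j).
    rewrite mevalB mevalXU mevalC inordK; last by lia.
    by move/eqP; rewrite subr_eq0 => /eqP.
  have := h ((Pmk f m (n./2 - m) \mPo [tuple 'X_(inord j) | j < (m + (n./2 - m)).+1])
     - (c ord_max)%:MP).
  rewrite mem_rcons inE eqxx => /(_ isT); rewrite mevalB mevalC comp_mpoly_meval.
  move/eqP; rewrite subr_eq0 => /eqP <-; apply: meval_eq => i.
  by rewrite tnth_mktuple mevalXU inordK //; have := ltn_ord i; lia.
move=> [hmu hE hP]; split=> // q; rewrite mem_rcons inE => /orP[/eqP->|/mapP[j _ ->]]; last first.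
  by rewrite mevalB mevalXU mevalC inordK ?hE ?subrr //; have := ltn_ord j; lia.
rewrite mevalB mevalC comp_mpoly_meval -hP; apply/eqP; rewrite subr_eq0; apply/eqP.
apply: meval_eq => i.
by rewrite tnth_mktuple mevalXU inordK //; have := ltn_ord i; lia.
Qed.

End Fixed.

End Final.

Theorem theorem8 (f : fieldType) (p : nat) (pchar_f : p \in [pchar f])
    (m n : nat) (ltmn : (m < n)%N) (lenp : (n <= p - 2)%N) :
  [/\ (* (1) *)
      (n <= 2 * m + 2)%N ->
        orbits f p m.+1 n.+1 = [set [set lam] | lam in Lquodual f p m.+1 n.+1] /\
        (forall O, orbits f p m.+1 n.+1 O -> gp_orbits f p m n O),
      (* (2) *)
      (2 * m + 2 < n)%N -> odd n ->
        set_bij [set c : 'I_m.+1 -> f | c ord0 != 0]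
          (gp_orbits f p m n) (orbit_plane f p m n) /\
        (forall c : 'I_m.+1 -> f, c ord0 != 0 ->
           affine_plane (n - 2 * m - 1) (orbit_plane f p m n c)),
      (* (3) *)
      (2 * m + 2 < n)%N -> ~~ odd n ->
        set_bij [set c : 'I_m.+2 -> f | c ord0 != 0]
          (gp_orbits f p m n)
          (fun c => zero_locus f p m n (orbit_equations f m n c)) /\
        (forall c : 'I_m.+2 -> f, c ord0 != 0 ->
           affine_variety (n - 2 * m - 2) (orbit_equations f m n c)),
      (* (4) *)
      forall O, gp_orbits f p m n O ->
        forall i, (n <= i <= p - 2)%N -> orbits f p m.+1 i.+1 O &
      (* (5) *)
      forall i, (m < i <= p - 2)%N ->
        forall O, orbits f p m.+1 i.+1 O ->
        exists2 n' : nat, (minn (2 * m + 2) i <= n' <= i)%N &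
          gp_orbits f p m n' O].
Proof.
have p_gt1 : (1 < p)%N by have /andP[/prime_gt1] := pchar_f.
have pre i : (i <= p - 2)%N -> (i < p.-1)%N by lia.
have lt_np := pre n lenp.
split.
- move=> le_n2; split; last by move=> O hO; split=> //; left.
  apply: eq_imagel => lam hlam; rewrite coad_orbitE //; last exact: leqW.
  apply/seteqP; split=> mu; last by move=> ->; exact: Gorbit_id.
  move=> [g Gg <-]; apply: (coad_trivial pchar_f (n := n)) => //; lia.
- move=> lt2 odd_n; split; last by move=> c _; apply: orbit_plane_affine.
  pose la (c : 'I_m.+1 -> f) := top_dual p m n (fun j => c (inord j)).
  have hla c : Lquodual f p m.+1 n.+1 (la c) by exact: top_dual_quo.
  have ela c (j : 'I_m.+1) : ell (n - j) (la c) = c j.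
    by rewrite ell_top_dual ?inord_val //; have := ltn_ord j; lia.
  have plane c : c ord0 != 0 -> Gorbit (la c) = orbit_plane f p m n c.
    move=> c0; rewrite (Gorbit_odd pchar_f ltmn lt_np) //; last by rewrite -[n]subn0 (ela c ord0).
    by congr (orbit_plane f p m n _); apply/funext => j; rewrite ela.
  split.
  + move=> c c0; apply/(gp_orbitsP pchar_f ltmn lt_np) => //.
    exists (la c); rewrite plane //; split=> //.
    by rewrite -[X in ell X]subn0 (ela c ord0).
  + move=> c c' /set_mem c0 _ E; apply/funext => j.
    have : orbit_plane f p m n c' (la c) by rewrite -E -plane //; exact: Gorbit_id.
    by move=> [_ /(_ j)]; rewrite ela.
  move=> O /(gp_orbitsP pchar_f ltmn lt_np)[//|lam [hlam l0 ->]].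
  exists (fun j : 'I_m.+1 => ell (n - j) lam); first by rewrite /= subn0.
  by rewrite (Gorbit_odd pchar_f ltmn lt_np).
- move=> lt2 even_n; set k := (n./2 - m)%N.
  have nE : n = (2 * (m + k))%N.
    have := odd_double_half n; rewrite (negPf even_n) -muln2 /k; lia.
  have k1 : (1 < k)%N by lia.
  have two : (2 : f) != 0 by apply: (two_neq0 pchar_f); lia.
  have leK : (m + k <= n - m.+1)%N by lia.
  have locus c := @zero_locusP f p pchar_f m n ltmn lt_np k c erefl leK.
  split; last first.
    move=> c c0; rewrite /orbit_equations -/k.
    have [d Ed] : exists d, n = (m.+2 + d + m.+1)%N by exists (n - m.+2 - m.+1)%N; lia.
    have -> : (n - m.+1 = m.+2 + d)%N by lia.
    have -> : (n - 2 * m - 2 = d.+1)%N by lia.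
    by apply: (level_affine_variety two (ltnW k1) c0); lia.
  have widen0 : widen_ord (leqnSn m.+1) ord0 = ord0 by exact: val_inj.
  have orbE lam c : Lquodual f p m.+1 n.+1 lam -> c ord0 != 0 ->
      (forall j : 'I_m.+1, ell (n - j) lam = c (widen_ord (leqnSn _) j)) ->
      (Pmk f m k).@[fun i => ell (n - i) lam] = c ord_max ->
      Gorbit lam = zero_locus f p m n (orbit_equations f m n c).
    move=> hlam c0 hE hP.
    rewrite (Gorbit_even pchar_f ltmn lt_np nE) //; last first.
      by rewrite -[X in ell X]subn0 (hE ord0) widen0.
    rewrite locus; apply/seteqP; split=> mu [hmu h1 h2]; split=> //.
    + by move=> j; rewrite -hE h1 // -ltnS.
    + by rewrite h2.
    + by move=> j lej; rewrite (h1 (Ordinal (lej : (j < m.+1)%N))) -hE.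
    by rewrite h2.
  have ex (c : 'I_m.+2 -> f) : c ord0 != 0 -> exists lam,
    [/\ Lquodual f p m.+1 n.+1 lam,
      forall j : 'I_m.+1, ell (n - j) lam = c (widen_ord (leqnSn _) j) &
      (Pmk f m k).@[fun i => ell (n - i) lam] = c ord_max].
    move=> c0; pose x (i : 'I_(m + k).+1) := c (inord i).
    have x0 : x ord0 != 0 by rewrite /x (_ : inord _ = ord0) //; apply: val_inj; rewrite /= inordK.
    have [x' [hx hP]] := Pmk_last_surj (c ord_max) two (ltnW k1) x0.
    exists (top_dual p m n (fun i => x' (inord i))); split; first exact: top_dual_quo.
      move=> j; have lt_j := ltn_ord j; rewrite ell_top_dual //; last by lia.
      rewrite hx /x inordK; [|lia..].
      by congr (c _); apply: val_inj; rewrite /= inordK // leqW.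
    rewrite -hP; apply: meval_eq => i; have := ltn_ord i; rewrite ltnS => lei.
    by rewrite ell_top_dual ?inord_val //; exact: leq_trans leK.
  split.
  + move=> c c0; apply/(gp_orbitsP pchar_f ltmn lt_np) => //.
    have [lam [hlam hE hP]] := ex c c0; exists lam; rewrite -(orbE lam c) //; split=> //.
    by rewrite -[X in ell X]subn0 (hE ord0) widen0.
  + move=> c c' /set_mem c0 _ E; apply/funext => j.
    have [lam [hlam hE hP]] := ex c c0.
    have : zero_locus f p m n (orbit_equations f m n c') lam.
      by rewrite -E -(orbE lam c) //; exact: Gorbit_id.
    rewrite locus => -[_ hE' hP'].
    case: (unliftP ord_max j) => [i ->|->]; last by rewrite -hP -hP'.
    have -> : lift ord_max i = widen_ord (leqnSn _) i.
      by apply: val_inj; rewrite /= /bump leqNgt ltn_ord.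
    by rewrite -hE hE'.
  move=> O /(gp_orbitsP pchar_f ltmn lt_np)[//|lam [hlam l0 ->]].
  pose c (j : 'I_m.+2) := if j == ord_max then (Pmk f m k).@[fun i => ell (n - i) lam]
     else ell (n - j) lam.
  exists c; first by rewrite /c /= subn0.
  symmetry; apply: orbE => //.
  + by rewrite /c /= subn0.
  + by move=> j; rewrite /c -val_eqE /= ltn_eqF.
  by rewrite /c eqxx.
- move=> O [/orbitsP-/(_ ltmn)[lam hlam ->] _] i /andP[le_ni le_ip].
  have lt_mi : (m < i)%N by exact: leq_trans le_ni.
  apply/orbitsP => //; exists lam => //.
  have /LquodualP := hlam; move=> /(_ pchar_f) h.
  apply/(LquodualP pchar_f); [exact: leqW | move=> j /andP[lt_ij lt_jp]].
  by apply: h; [exact: leqW | rewrite lt_jp andbT; exact: leq_ltn_trans lt_ij].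
(* n' is the index of the last nonzero coordinate, unless it is too small. *)
elim=> [//|i IH] /andP[lt_mi le_ip] O hO.
have [le2|lt2] := leqP i.+1 (2 * m + 2).
  by exists i.+1; [rewrite leqnn | split=> //; left].
have /orbitsP-/(_ lt_mi)[lam hlam OE] := hO.
have lt_ip := pre _ le_ip.
have [l0|l0] := eqVneq (ell i.+1 lam) 0; last first.
  exists i.+1; first by lia.
  by apply/(gp_orbitsP pchar_f lt_mi lt_ip) => //; exists lam.
have lt_mi' : (m < i)%N by lia.
have [||n' hn' hg] := IH _ O; [by rewrite lt_mi'; lia | | by exists n' => //; lia].
apply/orbitsP => //; exists lam => //.
apply/(LquodualP pchar_f); first exact: leqW.
move=> j /andP[lt_ij lt_jp]; case: (ltngtP j i.+1) => [|lt|->//]; first by lia.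
by move/(LquodualP pchar_f): hlam => -> //; [exact: leqW | rewrite lt].
Qed.
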